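(* In the setting described in the context, assume that $V^*$ is twice continuously differentiable on $\bar I\times\bar B_{2\widehat M}(0)$ with gradient and Hessian Lipschitz continuous (with respect to $y$, uniformly in $t\in\bar I$), and let $\sigma\in\mathcal{C}^4(\mathbb{R})$ be not a polynomial. Then there is a constant $c>0$ independent of $\varepsilon$ such that for every $\varepsilon>0$ there exist a residual network architecture, with parameter space $\mathcal{R}_\varepsilon$ and associated functions $V^\varepsilon_\theta$, and a parameter $\theta_\varepsilon\in\mathcal{R}_\varepsilon$ such that $(\theta,t,y)\mapsto V^\varepsilon_\theta(t,y)$ belongs to $\mathcal{C}^4(\mathcal{R}_\varepsilon\times\mathbb{R}\times\mathbb{R}^n)$ and $$\max_{t\in\bar I,\,|y|\le2\widehat M}\Big(|V^\varepsilon_{\theta_\varepsilon}(t,y)-V^*(t,y)|+|\partial_y(V^\varepsilon_{\theta_\varepsilon}(t,y)-V^*(t,y))|+\|\partial_{yy}(V^\varepsilon_{\theta_\varepsilon}(t,y)-V^*(t,y))\|\Big)\le c\,\varepsilon .$$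
   Context: Let $n,m\in\mathbb{N}$, $T>0$, $\bar I=[0,T]$, $f:\bar I\times\mathbb{R}^n\to\mathbb{R}^n$, $g:\bar I\times\mathbb{R}^n\to\mathbb{R}^{n\times m}$ be twice continuously differentiable, with Jacobians and Hessians in $y$ Lipschitz continuous on compact sets uniformly in $t$; $Q_1,Q_2\in\mathbb{R}^{n\times n}$ symmetric positive semi-definite, $\beta>0$, $y_d\in L^2(0,T;\mathbb{R}^n)$, $y_d^T\in\mathbb{R}^n$ (desired terminal state), and $\widehat M>0$ a fixed constant. The value function is $$V^*(t_0,y_0)=\inf\ \tfrac12\int_{t_0}^T\big(|Q_1(y(t)-y_d(t))|^2+\beta|u(t)|^2\big)dt+\tfrac12|Q_2(y(T)-y_d^T)|^2$$ over $y\in H^1(t_0,T;\mathbb{R}^n)$, $u\in L^2(t_0,T;\mathbb{R}^m)$ with $\dot y=f(t,y)+g(t,y)u$, $y(t_0)=y_0$; in particular $V^*(T,y_0)=\frac12|Q_2(y_0-y_d^T)|^2$. $\partial_y$, $\partial_{yy}$ denote gradient and Hessian with respect to $y$. Residual networks. An architecture consists of $L_\varepsilon\in\mathbb{N}$, $L_\varepsilon\ge2$, and widths $N^\varepsilon_0=n+1$, $N^\varepsilon_1,\dots,N^\varepsilon_{L_\varepsilon-1}\in\mathbb{N}$, $N^\varepsilon_{L_\varepsilon}=1$. Its parameter space is $$\mathcal{R}_\varepsilon=\prod_{i=1}^{L_\varepsilon-1}\big(\mathbb{R}^{N^\varepsilon_i\times N^\varepsilon_{i-1}}\times\mathbb{R}^{N^\varepsilon_i\times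 N^\varepsilon_{i-1}}\times\mathbb{R}^{N^\varepsilon_i}\big)\times\mathbb{R}^{N^\varepsilon_{L_\varepsilon}\times N^\varepsilon_{L_\varepsilon-1}},\qquad \theta=(W_{11},W_{12},b_1,\dots,W_{L_\varepsilon}).$$ With $\sigma$ applied componentwise, put $f^\sigma_{i,\theta}(x)=\sigma(W_{i1}x+b_i)+W_{i2}x$ for $i=1,\dots,L_\varepsilon-1$, $f^\sigma_{L_\varepsilon,\theta}(x)=W_{L_\varepsilon}x$, and $\Psi_\theta=f^\sigma_{L_\varepsilon,\theta}\circ\cdots\circ f^\sigma_{1,\theta}$. For $(t,y)\in\mathbb{R}\times\mathbb{R}^n$, $$V^\varepsilon_\theta(t,y)=\tfrac12|Q_2(y-y_d^T)|^2+\Psi_\theta((t,y))-\Psi_\theta((T,y)).$$ *)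

(* Defs.v *)
From HB Require Import structures.
From mathcomp Require Import all_boot all_order all_algebra.
From mathcomp Require Import all_classical all_reals all_analysis.

Set Implicit Arguments.
Unset Strict Implicit.
Unset Printing Implicit Defensive.
Import Order.TTheory GRing.Theory Num.Theory.
Import numFieldNormedType.Exports.

Local Open Scope classical_set_scope.
Local Open Scope ring_scope.

(* The library norm on matrices is the max norm. *)
Definition enorm (R : realType) n (v : 'cV[R]_n) : R :=
  Num.sqrt (\sum_i v i 0 ^+ 2).

Definition opnorm (R : realType) m n (A : 'M[R]_(m, n)) : R :=
  sup [set enorm (A *m x) | x in [set x : 'cV[R]_n | enorm x <= 1]].

Definition psd (R : realType) n (Q : 'M[R]_n) : Prop :=
  forall x : 'cV[R]_n, 0 <= (x^T *m Q *m x) 0 0.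

Section differentiability_classes.
Context (R : realType) (V W : normedModType R).
Implicit Types (f : V -> W) (K : set V).

(* Class C^k on the whole space: all iterated directional derivatives of order
   at most k exist and are continuous (V is meant to be finite-dimensional). *)
Fixpoint Ck (k : nat) f : Prop :=
  match k with
  | 0 => continuous f
  | k'.+1 => continuous f /\
      forall v, (forall x, derivable f x v) /\ Ck k' ('D_v f)
  end.

(* The extension by continuity to K of the derivative of f along v on the
   interior of K. *)
Definition derive_on K f (v : V) : V -> W :=
  fun z => lim ('D_v f x @[x --> within K° (nbhs z)]).

(* Class C^k on a set K contained in the closure of its interior: f is C^k on
   the interior, and f and its derivatives of order at most k extend
   continuously to K. The values of f outside K are irrelevant. As the filter
   [within K° (nbhs z)] charges z itself when z is interior, the convergence
   condition makes 'D_v f continuous on K° and equal there to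
   [derive_on K f v]. *)
Fixpoint Ck_on K (k : nat) f : Prop :=
  match k with
  | 0 => {within K, continuous f}
  | k'.+1 => {within K, continuous f} /\
      forall v,
        [/\ forall z, K° z -> derivable f z v,
            forall z, K z -> cvg ('D_v f x @[x --> within K° (nbhs z)])
          & Ck_on K k' (derive_on K f v)]
  end.

End differentiability_classes.

Section derivatives_in_y.
Context (R : realType) (n : nat).

Definition partial_y (W : normedModType R) (K : set (R * 'cV[R]_n))
    (F : R * 'cV[R]_n -> W) (i : 'I_n) : R * 'cV[R]_n -> W :=
  derive_on K F (0, delta_mx i 0).

Definition grad_y (K : set (R * 'cV[R]_n)) (F : R * 'cV[R]_n -> R)
    (z : R * 'cV[R]_n) : 'cV[R]_n :=
  \col_i partial_y K F i z.

Definition hess_y (K : set (R * 'cV[R]_n)) (F : R * 'cV[R]_n -> R)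
    (z : R * 'cV[R]_n) : 'M[R]_n :=
  \matrix_(i, j) partial_y K (partial_y K F j) i z.

(* Lipschitz in y in B, uniformly in t in I; N is the norm on the codomain. *)
Definition lipschitz_y (W : zmodType) (N : W -> R) (I : set R)
    (B : set 'cV[R]_n) (F : R * 'cV[R]_n -> W) : Prop :=
  exists L : R, forall t y1 y2, I t -> B y1 -> B y2 ->
    N (F (t, y1) - F (t, y2)) <= L * enorm (y1 - y2).

(* F is C^2 on [0, T] x R^n, with Jacobian and Hessian in y Lipschitz on
   compact sets uniformly in t; the columns dF/dy_i and d2F/dy_jdy_i are
   considered one by one. *)
Definition regular_coef (W : normedModType R) (T : R)
    (F : R * 'cV[R]_n -> W) : Prop :=
  let K := `[0, T] `*` [set: 'cV[R]_n] in
  [/\ Ck_on K 2 F,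
      forall B, compact B -> forall i,
        lipschitz_y Num.norm `[0, T] B (partial_y K F i)
    & forall B, compact B -> forall i j,
        lipschitz_y Num.norm `[0, T] B (partial_y K (partial_y K F i) j)].

End derivatives_in_y.

Section function_spaces.
Context (R : realType).
Notation mu := (@lebesgue_measure R).

Definition L2 n (a b : R) (u : R -> 'cV[R]_n) : Prop :=
  forall i, (fun t => u t i 0) \_ `[a, b] \in Lfun mu 2%:E.

Definition test_function (a b : R) (phi : R -> R) : Prop :=
  [/\ forall k, Ck k phi,
      compact (closure [set s | phi s != 0])
    & closure [set s | phi s != 0] `<=` `]a, b[].

(* y is the continuous representative of an element of H^1(a, b; R^n) with
   weak derivative w; for a = b this leaves y a unconstrained. *)
Definition H1_deriv n (a b : R) (y w : R -> 'cV[R]_n) : Prop :=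
  [/\ {within `[a, b], continuous y}, L2 a b y, L2 a b w
    & forall phi, test_function a b phi -> forall i,
        \int[mu]_(s in `[a, b]) (y s i 0 * derive1 phi s) =
        - \int[mu]_(s in `[a, b]) (w s i 0 * phi s)].

End function_spaces.

Section control_problem.
Context (R : realType) (n m : nat) (T : R).
Context (f : R * 'cV[R]_n -> 'cV[R]_n) (g : R * 'cV[R]_n -> 'M[R]_(n, m)).
Context (Q1 Q2 : 'M[R]_n) (beta : R) (yd : R -> 'cV[R]_n) (ydT : 'cV[R]_n).
Notation mu := (@lebesgue_measure R).

Definition admissible (t0 : R) (y0 : 'cV[R]_n)
    (y : R -> 'cV[R]_n) (u : R -> 'cV[R]_m) : Prop :=
  [/\ L2 t0 T u, y t0 = y0
    & exists w, H1_deriv t0 T y w /\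
        {ae mu, forall t, t0 <= t <= T -> w t = f (t, y t) + g (t, y t) *m u t}].

Definition terminal_cost (y : 'cV[R]_n) : R :=
  2^-1 * enorm (Q2 *m (y - ydT)) ^+ 2.

Definition cost (t0 : R) (y : R -> 'cV[R]_n) (u : R -> 'cV[R]_m) : \bar R :=
  ((2^-1)%:E * (\int[mu]_(t in `[t0, T])
     (enorm (Q1 *m (y t - yd t)) ^+ 2 + beta * enorm (u t) ^+ 2)%:E)
   + (terminal_cost (y T))%:E)%E.

(* z = (t0, y0); the value is +oo if no admissible pair exists. *)
Definition value_function (z : R * 'cV[R]_n) : \bar R :=
  ereal_inf [set c | exists y u, admissible z.1 z.2 y u /\ c = cost z.1 y u].

End control_problem.

Section residual_networks.
Context (R : realType).

(* An architecture with L layers and input dimension d is given by the list ws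
   of the L - 1 hidden widths; net_param d ws is the product of the triples
   (W_i1, W_i2, b_i) and of the last matrix, nested to the right. *)
Definition architecture (ws : seq nat) : Prop :=
  ws <> [::] /\ all (leq 1) ws.

Fixpoint net_param (d : nat) (ws : seq nat) : normedModType R :=
  match ws with
  | [::] => 'M[R]_(1, d)
  | w :: ws' =>
      ('M[R]_(w, d) * 'M[R]_(w, d) * 'cV[R]_w * net_param w ws')%type
  end.

Fixpoint net (sigma : R -> R) (d : nat) (ws : seq nat) :
    net_param d ws -> 'cV[R]_d -> R :=
  match ws return net_param d ws -> 'cV[R]_d -> R with
  | [::] => fun W x => (W *m x) 0 0
  | w :: ws' => fun theta x =>
      let: (W1, W2, b, theta') := theta in
      net sigma theta' (map_mx sigma (W1 *m x + b) + W2 *m x)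
  end.

Definition net_value (n : nat) (T : R) (Q2 : 'M[R]_n) (ydT : 'cV[R]_n)
    (sigma : R -> R) (ws : seq nat) (theta : net_param (1 + n) ws)
    (z : R * 'cV[R]_n) : R :=
  let Psi (t : R) (y : 'cV[R]_n) := net sigma theta (col_mx t%:M y) in
  terminal_cost Q2 ydT z.2 + Psi z.1 z.2 - Psi T z.2.

End residual_networks.

(* Main.v *)
Require Import Defs.
From HB Require Import structures.
From mathcomp Require Import all_boot all_order all_algebra.
From mathcomp Require Import ring lra.
From mathcomp Require Import all_classical all_reals all_analysis.

(** The statement reduces to an approximation of [V] itself.  A control problem
that starts at the final time only pays the terminal cost, so [V (T, y)] is
that cost ([value_function_end]), and on the cylinder [K] the error of the network value
is [D z - D (T, z.2)] with [D := Psi - V], where [Psi] is the network.  If [D]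
and its first and second [y]-derivatives are at most [eps] on [K], then so are
those of the trace [D (T, _)], because a [y]-derivative of the trace is the
trace of the [y]-derivative ([at_end_jet]).  Gradient, Hessian and value of the
error are thus at most [2 eps] entrywise, which gives
[c = 2 (1 + n + n^2)], the same for all [eps].

It remains to find a network that is uniformly close to [V] on [K], together
with the first and second derivatives in [y].  Convergence in this sense is
called C^2 below.  There are three steps.

[V] is replaced by a function defined everywhere ([jet_extension]): contract
the cylinder slightly towards its centre, so that only interior values of [V]
are used and the contracted function lives on a larger ball, and multiply by a
radial C^2 cutoff.  Uniform continuity of the derivatives makes this a small
C^2 perturbation.

The extended function is replaced by polynomials, one coordinate at a time
([bern_c2_cvg], [C2_approximable]).  Bernstein polynomials in one coordinate
are convex combinations of the values at the nodes, and their derivatives are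
convex combinations of difference quotients, that is, by the mean value
theorem, of values of the derivatives at nearby points; hence they converge
in C^2.  Their coefficients are functions of fewer coordinates, which allows an
induction on the number of coordinates.

Polynomials are replaced by networks.  As [sigma] is not affine, there is a
point [b] with [sigma''(b) != 0], and
[2 (sigma (b + h u) - sigma b - h sigma'(b) u) / (h^2 sigma''(b))] tends to
[u^2] in C^2 as [h] tends to 0 ([square_by_neuron]); the skip connections
provide the linear term.  Squares give products by polarization.  The skip
connections also carry everything computed so far to the next layer, so that
sums and products can be built one after the other by adding one layer with
one more neuron each time ([network_space_neuron], [approximableM]). *)

Set Implicit Arguments.
Unset Strict Implicit.
Unset Printing Implicit Defensive.
Import Order.TTheory GRing.Theory Num.Theory.
Import numFieldNormedType.Exports.

Local Open Scope classical_set_scope.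
Local Open Scope ring_scope.

(** * Smoothness along a set of directions *)

Section directional_smoothness.
Context (R : realType).

(** Directional derivatives are derivatives of functions of one real variable;
this transports the chain rule and the mean value theorem to them. *)
Lemma is_derive_line (V W : normedModType R) (f : V -> W) x v df :
  is_derive x v f df <-> is_derive (0 : R) 1 (fun h : R => f (h *: v + x)) df.
Proof.
have e : (fun h : R => h^-1 *: ((f \o shift x) (h *: v) - f x)) =
    (fun h => h^-1 *: (((fun k : R => f (k *: v + x)) \o shift 0) (h *: 1)
                       - f (0 *: v + x))).
  by rewrite funeqE => h /=; rewrite addr0 scale0r add0r [_%:A]mulr1.
split=> -[dv <-]; split.
- by move: dv; rewrite /derivable e.
- by rewrite /derive e.
- by move: dv; rewrite /derivable -e.
- by rewrite /derive -e.
Qed.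

Lemma is_derive_shift_line (V W : normedModType R) (f : V -> W) x v (s : R) df :
  is_derive (s *: v + x) v f df <->
  is_derive s 1 (fun h : R => f (h *: v + x)) df.
Proof.
rewrite is_derive_line (is_derive_line (fun h : R => f (h *: v + x)) s).
suff -> : (fun h : R => f (h *: v + (s *: v + x))) =
   (fun h : R => (fun k : R => f (k *: v + x)) (h *: 1 + s)) by [].
by rewrite funeqE => h; rewrite addrA -scalerDl [h *: 1]mulr1.
Qed.

Lemma is_derive_comp1 (V : normedModType R) (phi : R -> R) (f : V -> R) x v a b :
  is_derive (f x) 1 phi a -> is_derive x v f b ->
  is_derive x v (fun z => phi (f z)) (a * b).
Proof.
move=> dphi /is_derive_line df; apply/is_derive_line.
apply: (@is_derive1_comp R phi (fun h => f (h *: v + x))).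
by rewrite scale0r add0r.
Qed.

Lemma derive_funP (V : normedModType R) (f g : V -> R) v :
  (forall x, is_derive x v f (g x)) ->
  (forall x, derivable f x v) /\ 'D_v f = g.
Proof.
move=> h; split=> [x|]; first by case: (h x).
by apply/funext => x; case: (h x).
Qed.

(** [Ck] with restricted directions.  All directions are needed for the joint
smoothness in parameters and inputs; the directions of the state coordinates
are appropriate for functions that are merely continuous in time. *)
Fixpoint Ck_along (V : normedModType R) (E : set V) (k : nat) (f : V -> R) :
    Prop :=
  match k with
  | 0 => continuous f
  | k'.+1 => continuous f /\
      forall v, E v -> (forall x, derivable f x v) /\ Ck_along E k' ('D_v f)
  end.

Section class.
Context (V : normedModType R).
Implicit Types (E : set V) (f g : V -> R).

Lemma Ck_alongE E k f : Ck_along E k.+1 f <->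
  continuous f /\ forall v, E v -> exists g,
     (forall x, is_derive x v f (g x)) /\ Ck_along E k g.
Proof.
split=> -[cf h]; split=> // v Ev.
  by have [dv cv] := h v Ev; exists ('D_v f); split=> // x; exact: derivableP.
by have [g [/derive_funP[dv <-] cg]] := h v Ev.
Qed.

Lemma Ck_along_continuous E k f : Ck_along E k f -> continuous f.
Proof. by case: k => [|k] // []. Qed.

Lemma Ck_alongW E k f : Ck_along E k.+1 f -> Ck_along E k f.
Proof.
elim: k f => [|k IH] f; first by case.
move=> [cf h]; split=> // v Ev; have [dv cv] := h v Ev; split=> //.
exact: IH.
Qed.

Lemma Ck_along_cst E k c : Ck_along E k (fun=> c).
Proof.
elim: k c => [|k IH] c; first exact: cst_continuous.
apply/Ck_alongE; split; first exact: cst_continuous.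
by move=> v _; exists (fun=> 0); split=> // x; exact: is_derive_cst.
Qed.

Lemma Ck_alongD E k f g : Ck_along E k f -> Ck_along E k g ->
  Ck_along E k (fun x => f x + g x).
Proof.
elim: k f g => [|k IH] f g.
  by move=> cf cg x; apply: cvgD; [exact: cf|exact: cg].
move=> /Ck_alongE[cf hf] /Ck_alongE[cg hg]; apply/Ck_alongE; split.
  by move=> x; apply: cvgD; [exact: cf|exact: cg].
move=> v Ev; have [f' [df cf']] := hf v Ev; have [g' [dg cg']] := hg v Ev.
by exists (fun x => f' x + g' x); split=> [x|]; [exact: is_deriveD|exact: IH].
Qed.

Lemma Ck_alongM E k f g : Ck_along E k f -> Ck_along E k g ->
  Ck_along E k (fun x => f x * g x).
Proof.
elim: k f g => [|k IH] f g.
  by move=> cf cg x; apply: cvgM; [exact: cf|exact: cg].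
move=> sf sg; move: (sf) (sg) => /Ck_alongE[cf hf] /Ck_alongE[cg hg].
apply/Ck_alongE; split.
  by move=> x; apply: cvgM; [exact: cf|exact: cg].
move=> v Ev; have [f' [df cf']] := hf v Ev; have [g' [dg cg']] := hg v Ev.
exists (fun x => f x * g' x + g x * f' x); split=> [x|].
  exact: is_deriveM.
by apply: Ck_alongD; apply: IH => //; exact: Ck_alongW.
Qed.

Lemma Ck_alongZ E k c f : Ck_along E k f -> Ck_along E k (fun x => c * f x).
Proof. exact/Ck_alongM/Ck_along_cst. Qed.

Lemma Ck_alongB E k f g : Ck_along E k f -> Ck_along E k g ->
  Ck_along E k (fun x => f x - g x).
Proof.
move=> sf sg; have -> : (fun x => f x - g x) = (fun x => f x + (-1) * g x).
  by apply/funext => x; rewrite mulN1r.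
exact/Ck_alongD/Ck_alongZ.
Qed.

Lemma Ck_along_sum E k (I : Type) (r : seq I) (P : pred I) (F : I -> V -> R) :
  (forall i, Ck_along E k (F i)) ->
  Ck_along E k (fun x => \sum_(i <- r | P i) F i x).
Proof.
move=> sF; elim: r => [|i r IH].
  by under eq_fun do rewrite big_nil; exact: Ck_along_cst.
under eq_fun do rewrite big_cons.
by case: (P i) => //; exact: Ck_alongD.
Qed.

Lemma Ck_along_affine E k f (l : V -> R) :
  continuous f -> (forall h x v, f (h *: v + x) = h * l v + f x) ->
  Ck_along E k f.
Proof.
move=> cf lf; case: k => [|k] //; apply/Ck_alongE; split=> // v _.
exists (fun=> l v); split; last exact: Ck_along_cst.
move=> x; apply/is_derive_line.
have -> : (fun h : R => f (h *: v + x)) = (fun h => h * l v + f x).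
  by apply/funext => h; exact: lf.
by apply: is_derive_eq; rewrite addr0 scaler0 add0r [_ *: _]mulr1.
Qed.

End class.

Lemma Ck_along_comp (V : normedModType R) (E : set V) k (phi : R -> R)
    (f : V -> R) :
  Ck_along [set (1 : R)] k phi -> Ck_along E k f ->
  Ck_along E k (fun x => phi (f x)).
Proof.
elim: k phi f => [|k IH] phi f.
  by move=> cp cf x; apply: continuous_comp; [exact: cf|exact: cp].
move=> /Ck_alongE[cp hp] sf; move: (sf) => /Ck_alongE[cf hf].
apply/Ck_alongE; split.
  by move=> x; apply: continuous_comp; [exact: cf|exact: cp].
have [phi' [dphi cphi']] := hp 1 erefl.
move=> v Ev; have [f' [df cf']] := hf v Ev.
exists (fun x => phi' (f x) * f' x); split=> [x|].
  exact: is_derive_comp1.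
by apply: Ck_alongM => //; apply: IH => //; exact: Ck_alongW.
Qed.

Lemma Ck_of_along (V : normedModType R) k (f : V -> R) :
  Ck_along setT k f -> Ck k f.
Proof.
elim: k f => [|k IH] f //= [cf h]; split=> // v.
by have [dv cv] := h v I; split=> //; exact: IH.
Qed.

Lemma Ck_along_of (V : normedModType R) (E : set V) k (f : V -> R) :
  Ck k f -> Ck_along E k f.
Proof.
elim: k f => [|k IH] f //= [cf h]; split=> // v _.
by have [dv cv] := h v; split=> //; exact: IH.
Qed.

End directional_smoothness.

(** * Uniform bounds on a function and its first two derivatives *)

Section c2_seminorm.
Context (R : realType) (V : normedModType R) (n : nat) (e : 'I_n -> V).
Context (K : set V).
Implicit Types F G : V -> R.

Definition C2 F := Ck_along (range e) 2 F.

(** The closed ball of radius [eta] for the C^2 norm over [K] in the directions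
[e]; this reading is legitimate for functions in [C2] only, since ['D_v F] is
a junk value where [F] has no derivative. *)
Definition c2_le (eta : R) F := forall z, K z ->
  [/\ `|F z| <= eta, forall j, `|'D_(e j) F z| <= eta
    & forall i j, `|'D_(e i) ('D_(e j) F) z| <= eta].

(** The partial derivatives become named functions; their formulas can then be
given explicitly for sums, products and compositions. *)
Lemma C2P F : C2 F <-> continuous F /\ exists (F1 : 'I_n -> V -> R)
    (F2 : 'I_n -> 'I_n -> V -> R),
  [/\ forall j z, is_derive z (e j) F (F1 j z),
      forall i j z, is_derive z (e i) (F1 j) (F2 i j z),
      forall j, continuous (F1 j) & forall i j, continuous (F2 i j)].
Proof.
split=> [[cF h]|[cF [F1 [F2 [d1 d2 c1 c2]]]]].
  split=> //; exists (fun j => 'D_(e j) F), (fun i j => 'D_(e i) ('D_(e j) F)).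
  split=> [j z|i j z|j|i j].
  - by apply: derivableP; have [] := h (e j) (imageT _ _).
  - have [_ [_ /(_ (e i) (imageT _ _))[dv _]]] := h (e j) (imageT _ _).
    exact: derivableP.
  - by have [_ []] := h (e j) (imageT _ _).
  - have [_ [_ /(_ (e i) (imageT _ _))[_ cv]]] := h (e j) (imageT _ _).
    exact: cv.
split=> [|_ [j _ <-]]; first exact: cF.
have [dv ->] := derive_funP (d1 j); split; first exact: dv.
split; first exact: c1.
by move=> _ [i _ <-]; have [dv2 ->] := derive_funP (d2 i j); split => //; exact: c2.
Qed.

Lemma c2_leP F (F1 : 'I_n -> V -> R) (F2 : 'I_n -> 'I_n -> V -> R) eta :
  (forall j z, is_derive z (e j) F (F1 j z)) ->
  (forall i j z, is_derive z (e i) (F1 j) (F2 i j z)) ->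
  c2_le eta F <-> (forall z, K z -> [/\ `|F z| <= eta,
    forall j, `|F1 j z| <= eta & forall i j, `|F2 i j z| <= eta]).
Proof.
move=> d1 d2.
have e1 j : 'D_(e j) F = F1 j by have [] := derive_funP (d1 j).
have e2 i j : 'D_(e i) (F1 j) = F2 i j by have [] := derive_funP (d2 i j).
split=> h z Kz; have [h0 h1 h2] := h z Kz; split=> // [j|i j].
- by rewrite -e1.
- by rewrite -e2 -e1.
- by have := h1 j; rewrite -e1.
- by have := h2 i j; rewrite -e2 -e1.
Qed.

Lemma c2_leW eta eta' F : eta <= eta' -> c2_le eta F -> c2_le eta' F.
Proof.
move=> le h z Kz; have [h0 h1 h2] := h z Kz.
by split=> [|j|i j]; exact: le_trans le.
Qed.

Lemma c2_leD eta eta' F G : C2 F -> C2 G -> c2_le eta F -> c2_le eta' G ->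
  c2_le (eta + eta') (fun z => F z + G z).
Proof.
move=> /C2P[_ [F1 [F2 [dF1 dF2 _ _]]]] /C2P[_ [G1 [G2 [dG1 dG2 _ _]]]].
move=> /(c2_leP _ dF1 dF2) hF /(c2_leP _ dG1 dG2) hG.
have d1 j z : is_derive z (e j) (fun z => F z + G z) (F1 j z + G1 j z).
  exact: is_deriveD.
have d2 i j z : is_derive z (e i) (fun z => F1 j z + G1 j z) (F2 i j z + G2 i j z).
  exact: is_deriveD.
apply/(c2_leP _ d1 d2) => z Kz.
have [a0 a1 a2] := hF z Kz; have [b0 b1 b2] := hG z Kz.
by split=> [|j|i j]; rewrite (le_trans (ler_normD _ _))// lerD.
Qed.

(** By the Leibniz rule: the second derivative of a product has four terms. *)
Lemma c2_leM eta eta' F G : C2 F -> C2 G -> c2_le eta F -> c2_le eta' G ->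
  c2_le (4 * (eta * eta')) (fun z => F z * G z).
Proof.
move=> /C2P[_ [F1 [F2 [dF1 dF2 _ _]]]] /C2P[_ [G1 [G2 [dG1 dG2 _ _]]]].
move=> /(c2_leP _ dF1 dF2) hF /(c2_leP _ dG1 dG2) hG.
have d1 j z : is_derive z (e j) (fun z => F z * G z)
    (F z * G1 j z + G z * F1 j z).
  exact: is_deriveM.
have d2 i j z : is_derive z (e i) (fun z => F z * G1 j z + G z * F1 j z)
    ((F z * G2 i j z + G1 j z * F1 i z) + (G z * F2 i j z + F1 j z * G1 i z)).
  by apply: is_deriveD; exact: is_deriveM.
apply/(c2_leP _ d1 d2) => z Kz.
- have [a0 a1 a2] := hF z Kz; have [b0 b1 b2] := hG z Kz.
  have pe : 0 <= eta by exact: le_trans a0.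
  have pe' : 0 <= eta' by exact: le_trans b0.
  have pm : 0 <= eta * eta' by exact: mulr_ge0.
  have le2 x y : `|x| <= eta -> `|y| <= eta' -> `|x * y| <= eta * eta'.
    by move=> hx hy; rewrite normrM ler_pM.
  have le2' x y : `|x| <= eta -> `|y| <= eta' -> `|y * x| <= eta * eta'.
    by move=> hx hy; rewrite mulrC; exact: le2.
  split=> [|j|i j].
  + have := le2 _ _ a0 b0; lra.
  + rewrite (le_trans (ler_normD _ _))//.
    have := le2 _ _ a0 (b1 j); have := le2' _ _ (a1 j) b0; lra.
  + rewrite (le_trans (ler_normD _ _))//.
    have := ler_normD (F z * G2 i j z) (G1 j z * F1 i z).
    have := ler_normD (G z * F2 i j z) (F1 j z * G1 i z).
    have := le2 _ _ a0 (b2 i j); have := le2' _ _ (a2 i j) b0.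
    have := le2' _ _ (a1 i) (b1 j); have := le2 _ _ (a1 j) (b1 i).
    lra.
Qed.

(** By the chain rule; the three terms of the constant come from the first
derivative of [r] times at most one derivative of [F], and from the second
derivative of [r] times two first derivatives of [F]. *)
Lemma c2_le_comp eta B F (r r1 r2 : R -> R) : C2 F -> c2_le B F ->
  (forall u : R, is_derive u 1 r (r1 u)) -> (forall u : R, is_derive u 1 r1 (r2 u)) ->
  (forall u, `|u| <= B -> [/\ `|r u| <= eta, `|r1 u| <= eta & `|r2 u| <= eta]) ->
  c2_le (eta * (1 + B + B ^+ 2)) (fun z => r (F z)).
Proof.
move=> /C2P[_ [F1 [F2 [dF1 dF2 _ _]]]] /(c2_leP _ dF1 dF2) hF dr dr1 hr.
have d1 j z : is_derive z (e j) (fun z => r (F z)) (r1 (F z) * F1 j z).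
  exact: is_derive_comp1.
have d2 i j z : is_derive z (e i) (fun z => r1 (F z) * F1 j z)
    (r1 (F z) * F2 i j z + F1 j z * (r2 (F z) * F1 i z)).
  by apply: is_deriveM; exact: is_derive_comp1.
apply/(c2_leP _ d1 d2) => z Kz.
- have [a0 a1 a2] := hF z Kz; have [b0 b1 b2] := hr _ a0.
  have pe : 0 <= eta by exact: le_trans b0.
  have pB : 0 <= B by exact: le_trans a0.
  have pm : 0 <= eta * B by exact: mulr_ge0.
  have pm2 : 0 <= eta * B * B by exact: mulr_ge0.
  have le2 x y : `|x| <= eta -> `|y| <= B -> `|x * y| <= eta * B.
    by move=> hx hy; rewrite normrM ler_pM.
  split=> [|j|i j].
  + lra.
  + have := le2 _ _ b1 (a1 j); lra.
  + have := ler_normD (r1 (F z) * F2 i j z) (F1 j z * (r2 (F z) * F1 i z)).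
    have := le2 _ _ b1 (a2 i j).
    have : `|F1 j z * (r2 (F z) * F1 i z)| <= eta * B * B.
      by rewrite mulrC normrM ler_pM//; exact: le2.
    lra.
Qed.

Lemma c2_le_bounded F : compact K -> C2 F -> exists2 B, 0 < B & c2_le B F.
Proof.
move=> cK /C2P[cF [F1 [F2 [dF1 dF2 cF1 cF2]]]].
have bnd G : continuous G -> exists2 B, 0 <= B & forall z, K z -> `|G z| <= B.
  move=> cG; have [N [_ hN]] : bounded_set (G @` K).
    apply: compact_bounded; apply: continuous_compact => //.
    exact: continuous_subspaceT.
  exists (`|N| + 1); first by rewrite addr_ge0.
  move=> z Kz; apply: hN; last by exists z.
  by rewrite ltr_pwDr// ler_norm.
have [B0 B00 hB0] := bnd _ cF.
have /choice[B1 hB1] j : exists B1, 0 <= B1 /\ forall z, K z -> `|F1 j z| <= B1.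
  by have [B B_ge0 hB] := bnd _ (cF1 j); exists B.
have /choice[B2 hB2] (ij : 'I_n * 'I_n) :
    exists B2, 0 <= B2 /\ forall z, K z -> `|F2 ij.1 ij.2 z| <= B2.
  by have [B B_ge0 hB] := bnd _ (cF2 ij.1 ij.2); exists B.
have s1 : 0 <= \sum_j B1 j by apply: sumr_ge0 => j _; case: (hB1 j).
have s2 : 0 <= \sum_ij B2 ij by apply: sumr_ge0 => j _; case: (hB2 j).
exists (1 + B0 + \sum_j B1 j + \sum_ij B2 ij); first by lra.
apply/(c2_leP _ dF1 dF2) => z Kz; split=> [|j|i j].
- have := hB0 z Kz; lra.
- have : B1 j <= \sum_j B1 j.
    rewrite (bigD1 j)//= ler_wpDr// sumr_ge0// => k _.
    by case: (hB1 k).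
  have [_ /(_ z Kz)] := hB1 j; lra.
- have : B2 (i, j) <= \sum_ij B2 ij.
    rewrite (bigD1 (i, j))//= ler_wpDr// sumr_ge0// => k _.
    by case: (hB2 k).
  have [_ /(_ z Kz)] := hB2 (i, j); rewrite /=; lra.
Qed.

End c2_seminorm.

(** * Squaring with one neuron *)

Section quadratic_neuron.
Context (R : realType).

(** Mean value inequality.  Differentiability is required on [[-B, B]] only, so
that the lemma applies to functions known near one point. *)
Lemma increment_le (r r1 : R -> R) B eta :
  (forall u : R, `|u| <= B -> is_derive u 1 r (r1 u)) ->
  (forall u, `|u| <= B -> `|r1 u| <= eta) ->
  forall u, `|u| <= B -> `|r u - r 0| <= eta * `|u|.
Proof.
move=> dr h u uB.
have mvt a b : a <= b -> `|a| <= `|u| -> `|b| <= `|u| ->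
    exists2 c, `|c| <= `|u| & r b - r a = r1 c * (b - a).
  rewrite !ler_norml => ab /andP[a1 a2] /andP[b1 b2].
  have sub x : a <= x <= b -> `|x| <= `|u|.
    by move=> /andP[ax xb]; rewrite ler_norml; apply/andP; split; lra.
  have dab (x : R) : x \in `[a, b]%R -> is_derive x 1 r (r1 x).
    by rewrite in_itv /= => /sub xu; apply: dr; exact: le_trans uB.
  have cr : {within `[a, b], continuous r}.
    by apply: derivable_within_continuous => x /dab[].
  have dab' (x : R) : x \in `]a, b[%R -> is_derive x 1 r (r1 x).
    by move=> xab; apply: dab; exact: subset_itv_oo_cc xab.
  have [c] := @MVT_segment R r r1 a b ab dab' cr.
  by rewrite in_itv /= => /sub cu ->; exists c.
have [u0|u0] := leP 0 u.
  have [||c cu ->] := mvt 0 u u0; rewrite ?normr0//.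
  by rewrite subr0 normrM ler_wpM2r// h// (le_trans cu).
have [||c cu] := mvt u 0 (ltW u0); rewrite ?normr0// sub0r => e.
rewrite distrC e normrM normrN ler_wpM2r// h// (le_trans cu)//.
Qed.

(** Let [r] be the error made when the rescaled neuron replaces the square.  Its
second derivative is [2 s2 (h u + b) / s2 b - 2], uniformly small for small
[h]; as [r] and its first derivative vanish at 0, two applications of the mean
value inequality bound them as well. *)
Lemma square_by_neuron (s s1 s2 : R -> R) (b B eta : R) :
  (forall u : R, is_derive u 1 s (s1 u)) -> (forall u : R, is_derive u 1 s1 (s2 u)) ->
  {for b, continuous s2} -> s2 b != 0 -> 0 < B -> 0 < eta ->
  exists h a0 a1 a2 : R,
    let r u := a2 * s (h * u + b) + a1 * u + a0 - u ^+ 2 in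
    exists r1 r2, [/\ forall u : R, is_derive u 1 r (r1 u),
      forall u : R, is_derive u 1 r1 (r2 u) &
      forall u, `|u| <= B -> [/\ `|r u| <= eta, `|r1 u| <= eta & `|r2 u| <= eta]].
Proof.
move=> ds ds1 cs2 s2b B0 eta0.
(* a bound eta' on the second derivative costs a factor B per integration *)
set eta' := eta / (1 + B + B ^+ 2).
have den0 : 0 < 1 + B + B ^+ 2 by rewrite !addr_gt0// exprn_gt0.
have eta'0 : 0 < eta' by rewrite divr_gt0.
have ns2b : 0 < `|s2 b| / 2 by rewrite divr_gt0 ?normr_gt0.
have /cvgrPdist_le /(_ (eta' * (`|s2 b| / 2))) : s2 x @[x --> b] --> s2 b by exact: cs2.
move=> /(_ (mulr_gt0 eta'0 ns2b)) /nbhs_ballP[d /= d0 hd].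
(* keeps h u + b within d of b when |u| <= B *)
pose h := d / (2 * B).
have h0 : 0 < h by rewrite divr_gt0// mulr_gt0.
pose a2 := 2 / (s2 b * h ^+ 2).
pose a1 := - (a2 * h * s1 b).
pose a0 := - (a2 * s b).
exists h, a0, a1, a2; set r := (X in exists r1 r2, [/\ forall u : R, is_derive u 1 X _, _ & _]).
pose r1 u := a2 * h * s1 (h * u + b) + a1 - 2 * u.
pose r2 u := a2 * h ^+ 2 * s2 (h * u + b) - 2.
have daff (u : R) : is_derive u 1 (fun u : R => h * u + b) h.
  apply: is_derive_eq (is_deriveD _ _) _.
  by rewrite addr0 [_ *: _]mulr1.
have dr (u : R) : is_derive u 1 r (r1 u).
  have dcomp := @is_derive_comp1 R R _ (fun u => h * u + b) u 1 _ _ (ds _) (daff u).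
  have -> : r = (fun u => a2 *: s (h * u + b)) + a1 *: id + cst a0 - (id ^+ 2).
    by apply/funext => x /=; rewrite /r !fctE.
  have d2 : is_derive u 1 (fun u : R => a2 *: s (h * u + b)) (a2 *: (s1 (h * u + b) * h)).
    exact: is_deriveZ.
  apply: (is_derive_eq (is_deriveB (is_deriveD (is_deriveD d2
    (is_deriveZ _ _)) (is_derive_cst _ _ _)) (is_deriveX 1 _))).
  rewrite /r1 /GRing.scale /=; ring.
have dr1 (u : R) : is_derive u 1 r1 (r2 u).
  have dcomp := @is_derive_comp1 R R _ (fun u => h * u + b) u 1 _ _ (ds1 _) (daff u).
  have -> : r1 = (fun u => (a2 * h) *: s1 (h * u + b)) + cst a1 - (2 : R) *: id.
    by apply/funext => x /=; rewrite /r1 !fctE.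
  have d2 : is_derive u 1 (fun u : R => (a2 * h) *: s1 (h * u + b))
      ((a2 * h) *: (s2 (h * u + b) * h)).
    exact: is_deriveZ.
  apply: is_derive_eq.
  rewrite /r2 /GRing.scale /=; ring.
have hr2 u : `|u| <= B -> `|r2 u| <= eta'.
  move=> uB; have -> : r2 u = (2 / s2 b) * (s2 (h * u + b) - s2 b).
    rewrite /r2 /a2; by field; rewrite s2b lt0r_neq0.
  have ball_u : `|b - (h * u + b)| < d.
    rewrite opprD addrCA subrr addr0 normrN normrM (gtr0_norm h0).
    rewrite (@le_lt_trans _ _ (h * B))// ?ler_pM2l//.
    rewrite /h invfM mulrA -mulrA mulVf ?mulr1; [lra|exact: lt0r_neq0].
  have /(_ ball_u) := hd (h * u + b); rewrite distrC => le2.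
  rewrite normrM (@le_trans _ _ (`|2 / s2 b| * (eta' * (`|s2 b| / 2))))//.
    by rewrite ler_wpM2l.
  rewrite normrM normfV ger0_norm// le_eqVlt; apply/orP; left; apply/eqP.
  by field; rewrite normr_eq0.
have r10 : r1 0 = 0 by rewrite /r1 /a1 !mulr0 add0r; ring.
have r00 : r 0 = 0 by rewrite /r /a0 mulr0 add0r; ring.
have hr1 u : `|u| <= B -> `|r1 u| <= eta' * B.
  move=> uB; have := increment_le (fun u _ => dr1 u) hr2 uB; rewrite r10 subr0.
  by move=> /le_trans; apply; rewrite ler_wpM2l// ltW.
have hr u : `|u| <= B -> `|r u| <= eta' * B * B.
  move=> uB; have := increment_le (fun u _ => dr u) hr1 uB; rewrite r00 subr0.
  by move=> /le_trans; apply; rewrite ler_wpM2l// mulr_ge0// ltW.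
have le_eta x : x <= 1 + B + B ^+ 2 -> eta' * x <= eta.
  by move=> hx; rewrite /eta' mulrAC ler_pdivrMr// ler_pM2l.
exists r1, r2; split=> // u uB; split.
- rewrite (le_trans (hr u uB))// -mulrA; apply: le_eta; nra.
- rewrite (le_trans (hr1 u uB))//; apply: le_eta; nra.
- rewrite (le_trans (hr2 u uB))// -[leLHS]mulr1; apply: le_eta; nra.
Qed.

End quadratic_neuron.

(** * The algebra of functions approximable by networks *)

Section approximable_algebra.
Context (R : realType) (V : normedModType R) (n : nat) (e : 'I_n -> V).
Context (K : set V) (sigma : R -> R) (N : set (set (V -> R))).
Implicit Types (F G : V -> R) (S : set (V -> R)).

(** Each space [S] of the family stands for what an affine output layer can read
off the current hidden layer of a network; the last clause adds one neuron
without losing anything. *)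
Definition neuron_system :=
  [/\ forall S F, N S -> S F -> C2 e F,
      forall S c, N S -> S (fun=> c),
      forall S F G a b, N S -> S F -> S G -> S (fun z => a * F z + b * G z)
    & forall S F, N S -> S F -> exists S',
        [/\ N S', S `<=` S' & S' (fun z => sigma (F z))]].

(** The quantification over [S] makes this notion stable under sums and products:
the network for the second operand is built on top of the one for the first,
whose output remains available.  A fixed collection of networks would require
running networks of different depths in parallel. *)
Definition approximable G := C2 e G /\
  forall S eta, N S -> 0 < eta -> exists S',
    [/\ N S', S `<=` S'
      & exists2 F, S' F & c2_le e K eta (fun z => F z - G z)].

Lemma c2_le_cst c : c2_le e K `|c| (fun=> c).
Proof.
have d1 (j : 'I_n) z : is_derive z (e j) (fun=> c) (0 : R) by exact: is_derive_cst.
have d2 (i j : 'I_n) z : is_derive z (e i) (fun=> 0 : R) (0 : R).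
  exact: is_derive_cst.
apply/(c2_leP _ _ d1 d2) => z _; split=> // *; by rewrite normr0.
Qed.

Lemma c2_leZ eta c F : C2 e F -> c2_le e K eta F ->
  c2_le e K (4 * (`|c| * eta)) (fun z => c * F z).
Proof.
move=> cF hF; have cc : C2 e (fun=> c) by exact: Ck_along_cst.
exact: (c2_leM cc cF (c2_le_cst c) hF).
Qed.

Lemma approximable_all F : C2 e F -> (forall S, N S -> S F) -> approximable F.
Proof.
move=> cF h; split=> // S eta NS eta0; exists S; split=> //; exists F; first exact: h.
apply: (@c2_leW _ _ _ _ _ `|0 : R|); first by rewrite normr0 ltW.
have -> : (fun z => F z - F z) = (fun=> 0) by apply/funext => z; rewrite subrr.
exact: c2_le_cst.
Qed.

Hypothesis Nsys : neuron_system.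

Lemma approximable_cst c : approximable (fun=> c).
Proof.
case: Nsys => _ Ncst _ _.
by apply: approximable_all => [|S NS]; [exact: Ck_along_cst|exact: Ncst].
Qed.

Lemma approximable_lim G : C2 e G ->
  (forall eta, 0 < eta -> exists2 G', approximable G' &
     c2_le e K eta (fun z => G' z - G z)) -> approximable G.
Proof.
case: Nsys => NC2 _ _ _ cG h; split=> // S eta NS eta0.
have eta20 : 0 < eta / 2 by rewrite divr_gt0.
have [G' [cG' hG'] le1] := h _ eta20.
have [S' [NS' SS' [F S'F le2]]] := hG' _ _ NS eta20.
exists S'; split=> //; exists F => //.
have -> : (fun z => F z - G z) = (fun z => (F z - G' z) + (G' z - G z)).
  by apply/funext => z; rewrite addrA subrK.
have cF : C2 e F by exact: (NC2 _ _ NS' S'F).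
rewrite (splitr eta).
exact: (c2_leD (Ck_alongB cF cG') (Ck_alongB cG' cG) le2 le1).
Qed.

Lemma approximableD F G : approximable F -> approximable G ->
  approximable (fun z => F z + G z).
Proof.
case: Nsys => NC2 _ Nlin _ [cF hF] [cG hG]; split; first exact: (Ck_alongD cF cG).
move=> S eta NS eta0; have eta20 : 0 < eta / 2 by rewrite divr_gt0.
have [S1 [NS1 SS1 [F' S1F' leF]]] := hF _ _ NS eta20.
have [S2 [NS2 S12 [G' S2G' leG]]] := hG _ _ NS1 eta20.
exists S2; split=> //; first exact: subset_trans S12.
exists (fun z => 1 * F' z + 1 * G' z); first by apply: Nlin => //; exact: S12.
have -> : (fun z => 1 * F' z + 1 * G' z - (F z + G z)) =
    (fun z => (F' z - F z) + (G' z - G z)) by apply/funext => z; ring.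
have cF' : C2 e F' by exact: (NC2 _ _ NS1 S1F').
have cG' : C2 e G' by exact: (NC2 _ _ NS2 S2G').
rewrite (splitr eta).
exact: (c2_leD (Ck_alongB cF' cF) (Ck_alongB cG' cG) leF leG).
Qed.

Lemma approximableZ c F : approximable F -> approximable (fun z => c * F z).
Proof.
case: Nsys => NC2 _ Nlin _ [cF hF]; split; first exact: (Ck_alongZ c cF).
move=> S eta NS eta0.
have eta20 : 0 < eta / (4 * (`|c| + 1)) by rewrite divr_gt0// mulr_gt0// ltr_wpDl.
have [S1 [NS1 SS1 [F' S1F' leF]]] := hF _ _ NS eta20.
exists S1; split=> //; exists (fun z => c * F' z + 0 * F' z); first exact: Nlin.
have -> : (fun z => c * F' z + 0 * F' z - c * F z) = (fun z => c * (F' z - F z)).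
  by apply/funext => z; ring.
have cF' : C2 e F' by exact: (NC2 _ _ NS1 S1F').
apply: c2_leW (c2_leZ c (Ck_alongB cF' cF) leF).
have c0 : 0 < `|c| + 1 by rewrite ltr_wpDl.
have -> : 4 * (`|c| * (eta / (4 * (`|c| + 1)))) = eta * (`|c| / (`|c| + 1)).
  by field; rewrite gt_eqF.
apply: ler_piMr; first exact: ltW.
by rewrite ler_pdivrMr// mul1r lerDl.
Qed.

Section nonaffine.
Context (sigma1 sigma2 : R -> R) (b : R).
Hypothesis cK : compact K.
Hypothesis dsigma : forall u : R, is_derive u 1 sigma (sigma1 u).
Hypothesis dsigma1 : forall u : R, is_derive u 1 sigma1 (sigma2 u).
Hypothesis csigma2 : continuous sigma2.
Hypothesis sigma2b : sigma2 b != 0.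

(** Squaring is continuous in C^2, and one more neuron squares the network that
approximates [F]. *)
Lemma approximable_sqr F : approximable F -> approximable (fun z => F z * F z).
Proof.
case: Nsys => NC2 Ncst Nlin Nsig [cF hF]; split; first exact: (Ck_alongM cF cF).
move=> S eta NS eta0.
have [B B0 leB] := c2_le_bounded cK cF.
(* the first half of the error budget pays for replacing F by a network *)
pose eta1 := Num.min 1 (eta / (8 * (2 * B + 1))).
have den0 : 0 < 8 * (2 * B + 1) by lra.
have eta10 : 0 < eta1 by rewrite lt_min ltr01 divr_gt0.
have [S1 [NS1 SS1 [F' S1F' leF]]] := hF _ _ NS eta10.
have cF' : C2 e F' by exact: (NC2 _ _ NS1 S1F').
have cFF : C2 e (fun z => F' z - F z) := Ck_alongB cF' cF.
have leB' : c2_le e K (B + 1) F'.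
  have -> : F' = (fun z => F z + (F' z - F z)).
    by apply/funext => z; rewrite addrC subrK.
  apply: c2_leW (c2_leD cF cFF leB leF).
  by rewrite lerD2l ge_min lexx.
have le1 : c2_le e K (eta / 2) (fun z => F' z * F' z - F z * F z).
  have -> : (fun z => F' z * F' z - F z * F z) =
      (fun z => (F' z - F z) * (F' z + F z)) by apply/funext => z; ring.
  apply: c2_leW (c2_leM cFF (Ck_alongD cF' cF) leF (c2_leD cF' cF leB' leB)).
  have : eta1 * (8 * (2 * B + 1)) <= eta.
    by rewrite -ler_pdivlMr// ge_min lexx orbT.
  lra.
(* and the second half for squaring that network *)
pose eta2 := eta / 2 / (1 + (B + 1) + (B + 1) ^+ 2).
have den20 : 0 < 1 + (B + 1) + (B + 1) ^+ 2 by rewrite !addr_gt0// exprn_gt0// addr_gt0.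
have eta20 : 0 < eta2 by rewrite !divr_gt0.
have B10 : 0 < B + 1 by rewrite addr_gt0.
have [h [a0 [a1 [a2 [r1 [r2 [dr dr1 hr]]]]]]] :=
  square_by_neuron dsigma dsigma1 (@csigma2 b) sigma2b B10 eta20.
have S1aff : S1 (fun z => h * F' z + 1 * b) by apply: (Nlin _ _ (fun=> b) _ _ NS1) => //; exact: Ncst.
have [S2 [NS2 S12 S2s]] := Nsig _ _ NS1 S1aff.
exists S2; split=> //; first exact: subset_trans S12.
exists (fun z => 1 * (a2 * sigma (h * F' z + 1 * b) + a1 * F' z) + 1 * a0).
  apply: (Nlin _ _ (fun=> a0) _ _ NS2) => //; last exact: Ncst.
  by apply: Nlin => //; exact: S12.
set Q := (X in c2_le _ _ _ X).
have -> : Q = (fun z => (a2 * sigma (h * F' z + b) + a1 * F' z + a0 - F' z ^+ 2)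
                  + (F' z * F' z - F z * F z)).
  by apply/funext => z; rewrite /Q !mul1r; ring.
have le2 := c2_le_comp cF' leB' dr dr1 hr.
rewrite divfK ?gt_eqF// in le2.
have cs : C2 e (fun z => sigma (h * F' z + b)).
  have -> : (fun z => sigma (h * F' z + b)) = (fun z => sigma (h * F' z + 1 * b)).
    by apply/funext => z; rewrite mul1r.
  exact: (NC2 _ _ NS2 S2s).
have cq : C2 e (fun z => a2 * sigma (h * F' z + b) + a1 * F' z + a0 - F' z ^+ 2).
  apply: (Ck_alongB _ (Ck_alongM cF' cF')).
  apply: (Ck_alongD _ (Ck_along_cst _ _ _)).
  exact: (Ck_alongD (Ck_alongZ a2 cs) (Ck_alongZ a1 cF')).
rewrite (splitr eta).
exact: (c2_leD cq (Ck_alongB (Ck_alongM cF' cF') (Ck_alongM cF cF)) le2 le1).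
Qed.

(** By polarization. *)
Lemma approximableM F G : approximable F -> approximable G ->
  approximable (fun z => F z * G z).
Proof.
move=> aF aG.
have -> : (fun z => F z * G z) = (fun z => (2^-1 * ((F z + G z) * (F z + G z)) +
    (- 2^-1) * (F z * F z)) + (- 2^-1) * (G z * G z)).
  by apply/funext => z; field.
apply: approximableD; last exact/approximableZ/approximable_sqr.
apply: approximableD; last exact/approximableZ/approximable_sqr.
exact/approximableZ/approximable_sqr/approximableD.
Qed.

End nonaffine.
End approximable_algebra.

(** * Bernstein operators *)

Section bernstein.
Context (R : realType).

(** De Casteljau's recursion for the Bernstein polynomial
[sum_k c_k binomial(N, k) s^k (1 - s)^(N - k)], the expectation of [c] under
the binomial distribution.  In this form its properties follow by induction on
[N], and no binomial coefficient appears. *)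
Fixpoint bern (N : nat) (c : nat -> R) (s : R) : R :=
  match N with
  | 0 => c 0%N
  | N'.+1 => (1 - s) * bern N' c s + s * bern N' (fun k => c k.+1) s
  end.

Lemma bern_le N c d s : 0 <= s <= 1 ->
  (forall k, (k <= N)%N -> c k <= d k) -> bern N c s <= bern N d s.
Proof.
move=> /andP[s0 s1]; elim: N c d => [|N IH] c d h /=; first exact: h.
apply: lerD; apply: ler_wpM2l; rewrite ?subr_ge0//; apply: IH => k kN; apply: h.
  exact: leqW.
by [].
Qed.

Lemma bern_lin N a b c d s :
  bern N (fun k => a * c k + b * d k) s = a * bern N c s + b * bern N d s.
Proof.
by elim: N c d => [|N IH] c d //=; rewrite !IH; ring.
Qed.

Lemma bern_cst N c s : bern N (fun=> c) s = c.
Proof. by elim: N => [|N IH] //=; rewrite IH; ring. Qed.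

(** The second moment about [a] of the binomial distribution. *)
Lemma bern_var N a s :
  bern N (fun k => (k%:R - a) ^+ 2) s = N%:R * (s * (1 - s)) + (N%:R * s - a) ^+ 2.
Proof.
elim: N a => [|N IH] a /=; first by ring.
have -> : (fun k => (k.+1%:R - a) ^+ 2) = (fun k : nat => (k%:R - (a - 1)) ^+ 2).
  by apply/funext => k; rewrite -natr1; congr (_ ^+ 2); ring.
by rewrite !IH -natr1; ring.
Qed.

Lemma eq_bern N c d s : (forall k, (k <= N)%N -> c k = d k) ->
  bern N c s = bern N d s.
Proof.
elim: N c d => [|N IH] c d h /=; first exact: h.
by rewrite (IH c d) ?(IH (fun k => c k.+1) (fun k => d k.+1))// => k kN;
  apply: h => //; exact: leqW.
Qed.

(** Chebyshev's argument: values far from [g] are allowed at nodes far from [s],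
and the variance shows that these carry little mass. *)
Lemma bern_dist N c s g eps C : 0 <= s <= 1 -> (0 < N)%N -> 0 <= C ->
  (forall k, (k <= N)%N -> `|c k - g| <= eps + C * (k%:R / N%:R - s) ^+ 2) ->
  `|bern N c s - g| <= eps + C / N%:R.
Proof.
move=> s01 N0 C0 h.
have NR0 : 0 < N%:R :> R by rewrite ltr0n.
have -> : bern N c s - g = bern N (fun k => 1 * c k + (-1) * g) s.
  by rewrite (bern_lin N 1 (-1) c (fun=> g)) bern_cst; ring.
have bnd : bern N (fun k => eps * 1 + (C / N%:R ^+ 2) * (k%:R - N%:R * s) ^+ 2) s <=
    eps + C / N%:R.
  rewrite (bern_lin N _ _ (fun=> 1)) bern_cst bern_var subrr expr0n addr0 mulr1.
  rewrite lerD2l.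
  have -> : C / N%:R ^+ 2 * (N%:R * (s * (1 - s))) = C / N%:R * (s * (1 - s)).
    by field; rewrite gt_eqF.
  apply: ler_piMr; first by rewrite divr_ge0// ltW.
  by case/andP: s01 => s0 s1; nra.
have eqk k : eps * 1 + C / N%:R ^+ 2 * (k%:R - N%:R * s) ^+ 2 =
    eps + C * (k%:R / N%:R - s) ^+ 2.
  by field; rewrite gt_eqF.
rewrite ler_norml; apply/andP; split.
  rewrite lerNl (le_trans _ bnd)//.
  have -> : - bern N (fun k => 1 * c k + -1 * g) s =
      bern N (fun k => (-1) * (1 * c k + -1 * g) + 0 * 0) s.
    by rewrite (bern_lin N (-1) 0 _ (fun=> 0)); ring.
  apply: bern_le => // k kN; rewrite eqk.
  have := h k kN; rewrite ler_norml => /andP[]; lra.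
rewrite (le_trans _ bnd)//; apply: bern_le => // k kN; rewrite eqk.
have := h k kN; rewrite ler_norml => /andP[]; lra.
Qed.

(** The derivative with respect to [s] is [N] times the operator of degree [N - 1]
applied to forward differences.  The first term is present because the
coefficients may depend on the point as well. *)
Lemma bern_is_derive (V : normedModType R) N (c : nat -> V -> R) (c' : nat -> R)
    (s : V -> R) s' (z v : V) :
  (forall k, is_derive z v (c k) (c' k)) -> is_derive z v s s' ->
  is_derive z v (fun z => bern N (c^~ z) (s z))
    (bern N c' (s z) + s' * N%:R * bern N.-1 (fun k => c k.+1 z - c k z) (s z)).
Proof.
move=> dc ds; elim: N c c' dc => [|N IH] c c' dc.
  by apply: is_derive_eq (dc 0%N) _; rewrite mulr0 mul0r addr0.
have d1 := IH c c' dc.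
have d2 := IH (fun k => c k.+1) (fun k => c' k.+1) (fun k => dc k.+1).
have dm := is_deriveB (is_derive_cst (1 : R) z v) ds.
apply: is_derive_eq (is_deriveD (is_deriveM dm d1) (is_deriveM ds d2)) _.
rewrite /GRing.scale /= !fctE.
set A := bern N c' _; set B := bern N (fun k => c' k.+1) _.
have -> : bern N (fun k => c k.+1 z - c k z) (s z) =
    bern N (fun k => c k.+1 z) (s z) - bern N (c^~ z) (s z).
  have := bern_lin N 1 (-1) (fun k => c k.+1 z) (c^~ z) (s z).
  rewrite mul1r mulN1r => <-; apply: eq_bern => k _; ring.
case: N {IH d1 d2} @A @B => [|N] A B.
  by rewrite /=; ring.
rewrite -!natr1 /=.
have := bern_lin N 1 (-1) (fun k => c k.+1 z) (c^~ z) (s z).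
have := bern_lin N 1 (-1) (fun k => c k.+2 z) (fun k => c k.+1 z) (s z).
rewrite !mul1r !mulN1r.
have -> : bern N (fun k => 1 * c k.+2 z + -1 * c k.+1 z) (s z) =
   bern N (fun k => c k.+2 z - c k.+1 z) (s z) by apply: eq_bern => k _; ring.
have -> : bern N (fun k => 1 * c k.+1 z + -1 * c k z) (s z) =
   bern N (fun k => c k.+1 z - c k z) (s z) by apply: eq_bern => k _; ring.
move=> -> ->; ring.
Qed.

End bernstein.

(** * Mean values, mixed second derivatives, uniform continuity *)

Section mean_values.
Context (R : realType) (V : normedModType R).

Lemma mvt_line (F Fv : V -> R) (v : V) (h : R) z :
  (forall x, is_derive x v F (Fv x)) -> 0 <= h ->
  exists2 xi, 0 <= xi <= h & F (h *: v + z) - F z = h * Fv (xi *: v + z).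
Proof.
move=> dF h0.
have dl (x : R) : is_derive x 1 (fun k : R => F (k *: v + z)) (Fv (x *: v + z)).
  by apply: (is_derive_shift_line F z v x (Fv (x *: v + z))).1; exact: dF.
have cl : {within `[0, h], continuous (fun k : R => F (k *: v + z))}.
  apply: continuous_subspaceT => x.
  by apply/differentiable_continuous/derivable1_diffP; case: (dl x).
have [xi] := MVT_segment h0 (fun x _ => dl x) cl.
rewrite in_itv /= => xi0h; rewrite scale0r add0r subr0 => ->.
by exists xi => //; rewrite mulrC.
Qed.

(** The mean value theorem, first along [u] and then along [v]. *)
Lemma second_difference (F Fu Fvu : V -> R) (u v : V) (h : R) z :
  (forall x, is_derive x u F (Fu x)) -> (forall x, is_derive x v Fu (Fvu x)) ->
  0 <= h ->
  exists xi zeta, [/\ 0 <= xi <= h, 0 <= zeta <= h &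
    F (h *: u + (h *: v + z)) - F (h *: v + z) - (F (h *: u + z) - F z) =
    h ^+ 2 * Fvu (zeta *: v + (xi *: u + z))].
Proof.
move=> dF dFu h0.
have shift_derive (G Gu : V -> R) (w y : V) :
    (forall x, is_derive x w G (Gu x)) ->
    forall x, is_derive x w (fun x => G (x + y)) (Gu (x + y)).
  move=> dG x; apply/is_derive_line.
  have -> : (fun k : R => G (k *: w + x + y)) = (fun k : R => G (k *: w + (x + y))).
    by apply/funext => k; rewrite addrA.
  by apply: (is_derive_line G (x + y) w (Gu (x + y))).1; exact: dG.
have dpsi x : is_derive x u (fun x => F (x + h *: v) - F x)
    (Fu (x + h *: v) - Fu x).
  by apply: is_deriveB; exact: shift_derive.
have [xi xih exi] := mvt_line z dpsi h0.
have [zeta zh ez] := mvt_line (xi *: u + z) dFu h0.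
exists xi, zeta; split=> //.
rewrite expr2 -mulrA -ez [h *: v + (_ + z)]addrC -exi.
by rewrite -(addrA (h *: u) z) [z + h *: v]addrC; ring.
Qed.

(** The same second difference quotient converges to both mixed derivatives. *)
Lemma schwarz (F Fu Fv Fvu Fuv : V -> R) (u v : V) z :
  (forall x, is_derive x u F (Fu x)) -> (forall x, is_derive x v F (Fv x)) ->
  (forall x, is_derive x v Fu (Fvu x)) -> (forall x, is_derive x u Fv (Fuv x)) ->
  {for z, continuous Fvu} -> {for z, continuous Fuv} -> Fvu z = Fuv z.
Proof.
move=> dFu dFv dFvu dFuv c1 c2; apply/eqP; rewrite -subr_eq0 -normr_le0.
apply/ler_addgt0Pl => eps eps0; rewrite addr0.
have eps20 : 0 < eps / 2 by rewrite divr_gt0.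
have /cvgrPdist_le /(_ _ eps20) /nbhs_normP[d1 /= d10 h1] : Fvu x @[x --> z] --> Fvu z by exact: c1.
have /cvgrPdist_le /(_ _ eps20) /nbhs_normP[d2 /= d20 h2] : Fuv x @[x --> z] --> Fuv z by exact: c2.
pose d := Num.min d1 d2.
have d0 : 0 < d by rewrite lt_min d10 d20.
pose h := d / (2 * (`|u| + `|v| + 1)).
have uv0 : 0 < `|u| + `|v| + 1 by rewrite ltr_wpDl// addr_ge0.
have h0 : 0 < h by rewrite divr_gt0// mulr_gt0.
have small (a b : R) : 0 <= a <= h -> 0 <= b <= h -> `|z - (a *: u + (b *: v + z))| < d.
  move=> /andP[a0 ah] /andP[b0 bh].
  rewrite -opprB normrN addrA addrK (le_lt_trans (ler_normD _ _))// !normrZ !ger0_norm//.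
  rewrite (@le_lt_trans _ _ (h * (`|u| + `|v| + 1)))//.
    rewrite !mulrDr mulr1; apply: ler_wpDr; first exact: ltW.
    by apply: lerD; rewrite ler_wpM2r.
  have -> : h * (`|u| + `|v| + 1) = d / 2 by rewrite /h; field; rewrite gt_eqF.
  lra.
have [x1 [y1 [x1h y1h e1]]] := second_difference z dFu dFvu (ltW h0).
have [x2 [y2 [x2h y2h e2]]] := second_difference z dFv dFuv (ltW h0).
have : h ^+ 2 * Fvu (y1 *: v + (x1 *: u + z)) = h ^+ 2 * Fuv (y2 *: u + (x2 *: v + z)).
  by rewrite -e1 -e2 [h *: u + (h *: v + z)]addrCA; ring.
move=> /mulfI; rewrite expf_eq0 /= gt_eqF// => /(_ isT) e12.
have k1 := h1 (y1 *: v + (x1 *: u + z)).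
have k2 := h2 (y2 *: u + (x2 *: v + z)).
have : `|Fvu z - Fvu (y1 *: v + (x1 *: u + z))| <= eps / 2.
  apply: k1; rewrite /= addrCA (lt_le_trans (small _ _ x1h y1h))//.
  by rewrite ge_min lexx.
have : `|Fuv z - Fuv (y2 *: u + (x2 *: v + z))| <= eps / 2.
  apply: k2; rewrite /= (lt_le_trans (small _ _ y2h x2h))//.
  by rewrite ge_min lexx orbT.
rewrite e12 !ler_norml => /andP[? ?] /andP[? ?]; apply/andP; split; lra.
Qed.

(** Heine's theorem for a function that is continuous on [K] only. *)
Lemma compact_unif_continuous (K : set V) (G : V -> R) :
  compact K -> {within K, continuous G} -> forall eps, 0 < eps ->
  exists2 d, 0 < d & forall x y, K x -> K y -> `|x - y| < d -> `|G x - G y| < eps.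
Proof.
move=> cK /subspace_continuousP cG eps eps0.
pose P (d : R) (x : V) := K x -> forall y, K y -> `|x - y| < d -> `|G x - G y| < eps.
have /compact_near_coveringP /(_ R (0 : R)^'+ P) := cK.
move=> /(_ _)[x Kx|r /= r0 hr].
- have /cvgrPdist_lt /(_ (eps / 2)) := cG x Kx; rewrite divr_gt0// => /(_ isT).
  rewrite near_withinE => /nbhs_normP[r /= r0 hr].
  have r20 : 0 < r / 2 by rewrite divr_gt0.
  exists (ball_ Num.norm x (r / 2), [set d | 0 < d < r / 2]) => /=.
    split; first by apply/nbhs_normP; exists (r / 2).
    by exists (r / 2) => //= d; rewrite /ball_ /= add0r normrN => dr d0; rewrite d0 -(gtr0_norm d0).
  move=> [y d] /= [xy /andP[d0 dr]] Ky y' Ky' yd.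
  have h1 : `|G x - G y| < eps / 2.
    by apply: hr => //=; rewrite (lt_trans xy)// ltr_pdivrMr// ltr_pMr// ltr1n.
  have h2 : `|G x - G y'| < eps / 2.
    apply: hr => //=; rewrite -(subrK y x) -addrA (le_lt_trans (ler_normD _ _))//.
    by rewrite (splitr r) ltrD// (lt_trans yd).
  rewrite -(subrK (G x) (G y)) -addrA (le_lt_trans (ler_normD _ _))//.
  by rewrite (splitr eps) ltrD// distrC.
- have r20 : 0 < r / 2 by rewrite divr_gt0.
  exists (r / 2) => // x y Kx; apply: (hr (r / 2)) => //=.
  rewrite /ball_ /= add0r normrN gtr0_norm// ltr_pdivrMr// ltr_pMr// ltr1n//.
Qed.

End mean_values.

(** * Bernstein approximation in one coordinate *)

Section coordinate.
Context (R : realType) (V : normedModType R) (n : nat) (e : 'I_n -> V).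
Context (K : set V) (w : V) (a : R) (l s : V -> R).
Hypothesis a_gt0 : 0 < a.
Hypothesis s_affine : forall h v z, s (h *: v + z) = h * l v + s z.
Hypothesis s_continuous : continuous s.
Hypothesis lw : l w = a.
Hypothesis l_e : forall j, l (e j) = 0 \/ e j = w.

(** An abstract coordinate: [s] is an affine function with values in [[0, 1]] on
[K], increasing at speed [a] along [w], and [set_coord x z] is the point
obtained from [z] by moving along [w] until [s] equals [x].  It stands for time
or for a component of the state; each [e j] either is [w] or leaves [s]
unchanged. *)
Definition set_coord (x : R) (z : V) : V := ((x - s z) / a) *: w + z.

Hypothesis cK : compact K.
Hypothesis sK : forall z, K z -> 0 <= s z <= 1.
Hypothesis setK : forall x z, 0 <= x <= 1 -> K z -> K (set_coord x z).

Lemma set_coord_along x h v z : l v = 0 ->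
  set_coord x (h *: v + z) = h *: v + set_coord x z.
Proof. by move=> lv; rewrite /set_coord s_affine lv mulr0 add0r addrCA. Qed.

Lemma set_coord_across x h z : set_coord x (h *: w + z) = set_coord x z.
Proof.
rewrite /set_coord s_affine lw addrA -scalerDl; congr (_ *: _ + _).
by field; rewrite gt_eqF.
Qed.

Lemma set_coord_add x h z : set_coord (x + h) z = (h / a) *: w + set_coord x z.
Proof.
rewrite /set_coord addrA -scalerDl; congr (_ *: _ + _).
by field; rewrite gt_eqF.
Qed.

Lemma set_coord_continuous x : continuous (set_coord x).
Proof.
move=> z; apply: cvgD; last exact: cvg_id.
apply: cvgZr_tmp; apply: cvgMr_tmp; apply: cvgB; first exact: cvg_cst.
exact: s_continuous.
Qed.

Lemma s_derive z v : is_derive z v s (l v).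
Proof.
apply/is_derive_line.
have -> : (fun h : R => s (h *: v + z)) = (fun h => h * l v + s z).
  by apply/funext => h; exact: s_affine.
by apply: is_derive_eq; rewrite addr0 scaler0 add0r [_ *: _]mulr1.
Qed.

Lemma derive_set_coord_along (H Hv : V -> R) v x z : l v = 0 ->
  (forall y, is_derive y v H (Hv y)) ->
  is_derive z v (fun z => H (set_coord x z)) (Hv (set_coord x z)).
Proof.
move=> lv dH; apply/is_derive_line.
have -> : (fun h : R => H (set_coord x (h *: v + z))) =
    (fun h => H (h *: v + set_coord x z)).
  by apply/funext => h; rewrite set_coord_along.
by apply: (is_derive_line H (set_coord x z) v _).1; exact: dH.
Qed.

Lemma derive_set_coord_across (H : V -> R) x z :
  is_derive z w (fun z => H (set_coord x z)) 0.
Proof.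
apply/is_derive_line.
have -> : (fun h : R => H (set_coord x (h *: w + z))) =
    (fun h => H (set_coord x z)).
  by apply/funext => h; rewrite set_coord_across.
exact: is_derive_cst.
Qed.

Lemma C2_set_coord G x : C2 e G -> C2 e (fun z => G (set_coord x z)).
Proof.
move=> /C2P[cG [G1 [G2 [dG1 dG2 cG1 cG2]]]]; apply/C2P; split.
  by move=> z; apply: continuous_comp; [exact: set_coord_continuous|exact: cG].
exists (fun j z => if l (e j) == 0 then G1 j (set_coord x z) else 0).
exists (fun i j z => if l (e j) == 0 then
  (if l (e i) == 0 then G2 i j (set_coord x z) else 0) else 0).
split=> [j z|i j z|j|i j].
- have [lj|lj] := eqVneq (l (e j)) 0; first exact: derive_set_coord_along.
  case: (l_e j) lj => [->|-> _]; first by rewrite eqxx.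
  exact: derive_set_coord_across.
- case: eqP => lj; last exact: is_derive_cst.
  have [li|li] := eqVneq (l (e i)) 0; first exact: derive_set_coord_along.
  case: (l_e i) li => [->|-> _]; first by rewrite eqxx.
  exact: derive_set_coord_across.
- case: eqP => lj; last exact: cst_continuous.
  by move=> z; apply: continuous_comp; [exact: set_coord_continuous|exact: cG1].
- case: eqP => lj; last exact: cst_continuous.
  case: eqP => li; last exact: cst_continuous.
  by move=> z; apply: continuous_comp; [exact: set_coord_continuous|exact: cG2].
Qed.

(** Bernstein's theorem, uniformly on [K].  The nodes are allowed to deviate from
[k / N], because the mean value theorem evaluates derivatives at unknown points
near the nodes. *)
Lemma bern_set_coord_cvg G eps : continuous G -> 0 < eps ->
  exists N0, forall N, (N0 < N)%N -> forall (xi : nat -> R) z, K z ->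
    (forall k, (k <= N)%N -> 0 <= xi k <= 1 /\ `|xi k - k%:R / N%:R| <= 2 / N%:R) ->
    `|bern N (fun k => G (set_coord (xi k) z)) (s z) - G z| <= eps.
Proof.
move=> cG eps0; have eps20 : 0 < eps / 2 by rewrite divr_gt0.
have [d d0 hd] := compact_unif_continuous cK (continuous_subspaceT cG) eps20.
have [M [_ hM]] : bounded_set (G @` K).
  apply: compact_bounded; apply: continuous_compact => //.
  exact: continuous_subspaceT.
pose B := `|M| + 1.
have B0 : 0 <= B by rewrite addr_ge0.
have GB z : K z -> `|G z| <= B.
  by move=> Kz; apply: hM; [rewrite ltr_pwDr// ler_norm|exists z].
(* where set_coord moves z by at least d, the increment of G is at most 2 B,
   which is below C0 times the squared displacement of the coordinate *)
pose C0 := 2 * B * (`|w| / a / d) ^+ 2.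
have C00 : 0 <= C0 by rewrite mulr_ge0// ?sqr_ge0// mulr_ge0.
have quad x z : 0 <= x <= 1 -> K z ->
    `|G (set_coord x z) - G z| <= eps / 2 + C0 * (x - s z) ^+ 2.
  move=> x01 Kz; have Kx := setK x01 Kz.
  have [near|far] := ltP `|set_coord x z - z| d.
    rewrite (le_trans (ltW (hd _ _ Kx Kz near)))// lerDl.
    by rewrite mulr_ge0// sqr_ge0.
  have le2B : `|G (set_coord x z) - G z| <= 2 * B.
    by rewrite (le_trans (ler_normB _ _))// mulr_natl mulr2n lerD// GB.
  rewrite (le_trans le2B)// ler_wpDl ?(ltW eps20)// /C0 -mulrA.
  apply: ler_peMr; first by rewrite mulr_ge0.
  rewrite -exprMn -[X in X <= _](expr1n _ 2) -[leRHS]real_normK ?num_real//.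
  rewrite ler_pXn2r ?nnegrE// normrM !normrM normrV ?unitfE ?gt_eqF//.
  rewrite !normfV (gtr0_norm d0) (gtr0_norm a_gt0) normr_id.
  have -> : `|w| / a / d * `|x - s z| = (`|x - s z| / a * `|w|) / d.
    by field; rewrite !gt_eqF.
  rewrite ler_pdivlMr// mul1r (le_trans far)//.
  by rewrite /set_coord addrK normrZ normrM normfV (gtr0_norm a_gt0).
(* (xi k - s)^2 <= 2 (k / N - s)^2 + 8 / N^2, so the error is at most
   eps / 2 + 8 C0 / N^2 + 2 C0 / N <= eps / 2 + 10 C0 / N *)
exists (Num.bound (20 * C0 / eps)) => N hN xi z Kz hxi.
have N0 : (0 < N)%N by exact: leq_ltn_trans hN.
have NR0 : 0 < N%:R :> R by rewrite ltr0n.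
have bigN : 20 * C0 / eps <= N%:R.
  have c0 : 0 <= 20 * C0 / eps.
    by apply: divr_ge0; [exact: mulr_ge0|exact: ltW].
  apply: (le_trans (ltW (archi_boundP c0))); rewrite ler_nat; exact: ltnW.
have := @bern_dist R N (fun k => G (set_coord (xi k) z)) (s z) (G z)
  (eps / 2 + 8 * C0 / N%:R ^+ 2) (2 * C0) (sK Kz) N0.
rewrite mulr_ge0// => /(_ isT) h; apply: (le_trans (h _)).
  move=> k kN; have [x01 xk] := hxi k kN.
  rewrite (le_trans (quad _ _ x01 Kz))//.
  set y := k%:R / N%:R in xk *.
  have : (xi k - s z) ^+ 2 <= 2 * (y - s z) ^+ 2 + 2 * (xi k - y) ^+ 2.
    have := sqr_ge0 ((xi k - y) - (y - s z)); rewrite !expr2; lra.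
  have : (xi k - y) ^+ 2 <= (2 / N%:R) ^+ 2.
    by rewrite -(real_normK (num_real (xi k - y))) ler_pXn2r// ?nnegrE// divr_ge0.
  have -> : (2 / N%:R) ^+ 2 = 4 / N%:R ^+ 2 :> R by field; rewrite gt_eqF.
  have -> : 8 * C0 / N%:R ^+ 2 = 2 * C0 * (4 / N%:R ^+ 2) by ring.
  move: (4 / _) (sqr_ge0 (y - s z)) (sqr_ge0 (xi k - y)) => q.
  move: (_ ^+ 2) => A1; move: (_ ^+ 2) => A2; move: (_ ^+ 2) => A3.
  move=> p1 p2 l1 l2; nra.
have le1 : 8 * C0 / N%:R ^+ 2 <= 8 * C0 / N%:R.
  apply: ler_wpM2l; first exact: mulr_ge0.
  rewrite lef_pV2 ?posrE ?exprn_gt0//.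
  by rewrite expr2 ler_peMl ?(ltW NR0)// ler1n.
have le2 : 20 * C0 / N%:R <= eps.
  by rewrite ler_pdivrMr// [leRHS]mulrC -ler_pdivrMr.
have -> : 2 * C0 / N%:R = C0 / N%:R * 2 by ring.
have : 20 * C0 / N%:R = C0 / N%:R * 20 by ring.
have : 8 * C0 / N%:R = C0 / N%:R * 8 by ring.
lra.
Qed.

Lemma bern_derive_along N (x : nat -> R) (H Hv : V -> R) v : l v = 0 ->
  (forall y, is_derive y v H (Hv y)) -> forall z,
  is_derive z v (fun z => bern N (fun k => H (set_coord (x k) z)) (s z))
    (bern N (fun k => Hv (set_coord (x k) z)) (s z)).
Proof.
move=> lv dH z.
apply: is_derive_eq (bern_is_derive N
  (fun k => derive_set_coord_along (x k) z lv dH) (s_derive z v)) _.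
by rewrite lv !mul0r addr0.
Qed.

Lemma bern_derive_across N (x : nat -> R) (H : V -> R) z :
  is_derive z w (fun z => bern N.+1 (fun k => H (set_coord (x k) z)) (s z))
    (a * N.+1%:R * bern N (fun k => H (set_coord (x k.+1) z)
                                    - H (set_coord (x k) z)) (s z)).
Proof.
apply: is_derive_eq (bern_is_derive N.+1
  (fun k => derive_set_coord_across H (x k) z) (s_derive z w)) _.
by rewrite lw bern_cst add0r.
Qed.

(** Coefficients of the form [H (set_coord (x k) z)] do not vary along [w], and
neither do their differences; hence only the degree drops. *)
Lemma bern_derive_across2 N (x : nat -> R) (H : V -> R) c z :
  is_derive z w (fun z => c * bern N.+1 (fun k => H (set_coord (x k.+1) z)
                                    - H (set_coord (x k) z)) (s z))
    (c * (a * N.+1%:R * bern N (fun k =>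
        (H (set_coord (x k.+2) z) - H (set_coord (x k.+1) z))
        - (H (set_coord (x k.+1) z) - H (set_coord (x k) z))) (s z))).
Proof.
have d k : is_derive z w (fun z => H (set_coord (x k.+1) z) - H (set_coord (x k) z)) 0.
  apply: is_derive_eq (is_deriveB (derive_set_coord_across H (x k.+1) z)
    (derive_set_coord_across H (x k) z)) _.
  by rewrite subrr.
apply: is_derive_eq (is_deriveZ c (bern_is_derive N.+1 d (s_derive z w))) _.
by rewrite lw bern_cst add0r.
Qed.

Lemma bern_derive_along2 N (x : nat -> R) (H Hv : V -> R) v c : l v = 0 ->
  (forall y, is_derive y v H (Hv y)) -> forall z,
  is_derive z v (fun z => c * bern N (fun k => H (set_coord (x k.+1) z)
                                    - H (set_coord (x k) z)) (s z))
    (c * bern N (fun k => Hv (set_coord (x k.+1) z)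
                                    - Hv (set_coord (x k) z)) (s z)).
Proof.
move=> lv dH z.
have d k : is_derive z v (fun z => H (set_coord (x k.+1) z) - H (set_coord (x k) z))
    (Hv (set_coord (x k.+1) z) - Hv (set_coord (x k) z)).
  exact: is_deriveB (derive_set_coord_along (x k.+1) z lv dH)
    (derive_set_coord_along (x k) z lv dH).
apply: is_derive_eq (is_deriveZ c (bern_is_derive N d (s_derive z v))) _.
by rewrite lv !mul0r addr0.
Qed.

Let x_ N (k : nat) : R := k%:R / N%:R.

(** The factor [a * N] that comes out of a derivative is the inverse of the step
between two nodes, so the differences become difference quotients, which are
values of the derivative. *)
Lemma bern_first_difference N (H Hw : V -> R) z :
  (forall y, is_derive y w H (Hw y)) ->
  exists2 xi : nat -> R,
    a * N.+2%:R * bern N.+1 (fun k => H (set_coord (x_ N.+2 k.+1) z)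
                                     - H (set_coord (x_ N.+2 k) z)) (s z)
    = bern N.+1 (fun k => Hw (set_coord (xi k) z)) (s z) &
    forall k, (k <= N.+1)%N -> 0 <= xi k <= 1 /\ `|xi k - k%:R / N.+1%:R| <= 2 / N.+1%:R.
Proof.
move=> dH; have N20 : 0 < N.+2%:R :> R by rewrite ltr0n.
have N10 : 0 < N.+1%:R :> R by rewrite ltr0n.
have eN : N.+2%:R = N.+1%:R + 1 :> R by rewrite -natr1.
pose h : R := 1 / N.+2%:R.
have h0 : 0 < h by rewrite divr_gt0.
have /choice[xi hxi] k : exists xi, 0 <= xi <= h / a /\
   H (set_coord (x_ N.+2 k.+1) z) - H (set_coord (x_ N.+2 k) z) =
   h / a * Hw (xi *: w + set_coord (x_ N.+2 k) z).
  have [xi xih e1] := mvt_line (set_coord (x_ N.+2 k) z) dH (ltW (divr_gt0 h0 a_gt0)).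
  exists xi; split=> //; rewrite -e1 -set_coord_add; congr (H (set_coord _ _) - _).
  by rewrite /x_ /h -natr1 mulrDl.
exists (fun k => x_ N.+2 k + a * xi k).
  rewrite (_ : bern N.+1 (fun k => Hw _) _ = bern N.+1 (fun k =>
    (a * N.+2%:R) * (H (set_coord (x_ N.+2 k.+1) z) - H (set_coord (x_ N.+2 k) z))
    + 0 * 0) (s z)); first by rewrite (bern_lin N.+1 _ 0 _ (fun=> 0)) mul0r addr0.
  apply: eq_bern => k _; have [_ ->] := hxi k.
  rewrite set_coord_add mulrAC divff ?gt_eqF// mul1r /h.
  by field; rewrite !gt_eqF.
move=> k kN; have [/andP[xi0 xih] _] := hxi k.
have axi : a * xi k <= h by rewrite mulrC -ler_pdivlMr.
have axi0 : 0 <= a * xi k by rewrite mulr_ge0// ltW.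
have kR : k%:R <= N.+1%:R :> R by rewrite ler_nat.
have x0 : 0 <= x_ N.+2 k by rewrite divr_ge0.
have e2 : x_ N.+2 k - k%:R / N.+1%:R = - (k%:R / N.+1%:R) * h.
  rewrite /x_ /h eN; move: (N.+1%:R) N10 => q q0.
  by field; rewrite !gt_eqF ?addr_gt0.
split.
  rewrite addr_ge0//=; apply: (@le_trans _ _ (x_ N.+2 k + h)); first by rewrite lerD2l.
  by rewrite /x_ /h -mulrDl ler_pdivrMr// mul1r natr1 ler_nat.
have kk : 0 <= (k%:R / N.+1%:R : R) <= 1.
  by rewrite divr_ge0//= ler_pdivrMr// mul1r.
have hN : h <= 1 / N.+1%:R.
  by rewrite /h ler_pM2l// lef_pV2 ?posrE// ler_nat.
rewrite addrAC e2 ler_norml; move: kk => /andP[]; move: (k%:R / _) => q q0 q1.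
have qh0 : 0 <= q * h by rewrite mulr_ge0// ltW.
have qh1 : q * h <= h by rewrite ler_piMl// ltW.
have -> : 2 / N.+1%:R = 2 * (1 / N.+1%:R) :> R by rewrite mul1r.
move: (1 / N.+1%:R) hN => r hN; have r0 : 0 <= r by exact: le_trans (ltW h0) hN.
by apply/andP; split; lra.
Qed.

(** As for first differences, but the factors [N + 2] and [N + 1] of two successive
derivatives do not match the squared mesh [(N + 2)^2] exactly. *)
Lemma bern_second_difference N (H Hw Hww : V -> R) z : (0 < N)%N ->
  (forall y, is_derive y w H (Hw y)) -> (forall y, is_derive y w Hw (Hww y)) ->
  exists2 xi : nat -> R,
    a * N.+2%:R * (a * N.+1%:R * bern N (fun k =>
      (H (set_coord (x_ N.+2 k.+2) z) - H (set_coord (x_ N.+2 k.+1) z))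
      - (H (set_coord (x_ N.+2 k.+1) z) - H (set_coord (x_ N.+2 k) z))) (s z))
    = N.+1%:R / N.+2%:R * bern N (fun k => Hww (set_coord (xi k) z)) (s z) &
    forall k, (k <= N)%N -> 0 <= xi k <= 1 /\ `|xi k - k%:R / N%:R| <= 2 / N%:R.
Proof.
move=> N0 dH dHw; have N20 : 0 < N.+2%:R :> R by rewrite ltr0n.
have N00 : 0 < N%:R :> R by rewrite ltr0n.
have eN : N.+2%:R = N%:R + 2 :> R by rewrite -addn2 natrD.
pose h : R := 1 / N.+2%:R.
have h0 : 0 < h by rewrite divr_gt0.
have x_S k : x_ N.+2 k.+1 = x_ N.+2 k + h by rewrite /x_ /h -natr1 mulrDl.
have /choice[xi hxi] k : exists xi, 0 <= xi <= 2 * (h / a) /\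
   (H (set_coord (x_ N.+2 k.+2) z) - H (set_coord (x_ N.+2 k.+1) z))
      - (H (set_coord (x_ N.+2 k.+1) z) - H (set_coord (x_ N.+2 k) z)) =
   (h / a) ^+ 2 * Hww (xi *: w + set_coord (x_ N.+2 k) z).
  have [x [y [/andP[x0 xh] /andP[y0 yh] e1]]] := second_difference
    (set_coord (x_ N.+2 k) z) dH dHw (ltW (divr_gt0 h0 a_gt0)).
  exists (y + x); split; first by rewrite addr_ge0//= mulr_natl mulr2n lerD.
  by rewrite scalerDl -(addrA (y *: w)) -e1 x_S x_S !set_coord_add.
exists (fun k => x_ N.+2 k + a * xi k).
  rewrite (_ : N.+1%:R / N.+2%:R * bern N (fun k => Hww _) _ = bern N (fun k =>
    (a * N.+2%:R * (a * N.+1%:R)) *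
      ((H (set_coord (x_ N.+2 k.+2) z) - H (set_coord (x_ N.+2 k.+1) z))
      - (H (set_coord (x_ N.+2 k.+1) z) - H (set_coord (x_ N.+2 k) z)))
    + 0 * 0) (s z)).
    by rewrite (bern_lin N _ 0 _ (fun=> 0)) mul0r addr0 !mulrA.
  rewrite -[LHS]addr0 -[X in _ + X](mul0r (bern N (fun=> 0) (s z))) -bern_lin.
  apply: eq_bern => k _; have [_ ->] := hxi k.
  rewrite set_coord_add [a * xi k / a]mulrAC divff ?gt_eqF// mul1r /h.
  by field; rewrite !gt_eqF.
move=> k kN; have [/andP[xi0 xih] _] := hxi k.
have axi : a * xi k <= 2 * h by rewrite mulrC -ler_pdivlMr// -mulrA.
have axi0 : 0 <= a * xi k by rewrite mulr_ge0// ltW.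
have kR : k%:R <= N%:R :> R by rewrite ler_nat.
have x0 : 0 <= x_ N.+2 k by rewrite divr_ge0.
have e2 : x_ N.+2 k - k%:R / N%:R = - (k%:R / N%:R) * (2 * h).
  rewrite /x_ /h eN; move: (N%:R) N00 => q q0.
  by field; rewrite !gt_eqF ?addr_gt0.
split.
  rewrite addr_ge0//=; apply: (@le_trans _ _ (x_ N.+2 k + 2 * h)); first by rewrite lerD2l.
  rewrite /x_ /h mulrA mulr1 -mulrDl ler_pdivrMr// mul1r eN lerD2r//.
have kk : 0 <= (k%:R / N%:R : R) <= 1.
  by rewrite divr_ge0//= ler_pdivrMr// mul1r.
have hN : 2 * h <= 2 / N%:R.
  by rewrite /h mul1r ler_pM2l// lef_pV2 ?posrE// ler_nat -addn2 leq_addr.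
rewrite addrAC e2 ler_norml; move: kk => /andP[]; move: (k%:R / _) => q q0 q1.
have qh0 : 0 <= q * (2 * h) by rewrite mulr_ge0// mulr_ge0// ltW.
have qh1 : q * (2 * h) <= 2 * h by rewrite ler_piMl// mulr_ge0// ltW.
move: (2 / N%:R) hN => r hN; have r0 : 0 <= r by lra.
by apply/andP; split; lra.
Qed.

(** Derivatives along directions that leave [s] unchanged commute with the
operator; those along [w] turn into difference quotients.  If both kinds occur,
the difference quotient is taken in the derivative along the other direction,
so the limit is a mixed derivative with [w] last; by symmetry the order does
not matter. *)
Lemma bern_c2_cvg G eps : C2 e G -> 0 < eps ->
  exists N, c2_le e K eps (fun z =>
    bern N (fun k => G (set_coord (x_ N k) z)) (s z) - G z).
Proof.
move=> CG eps0; have [B B0 leB] := c2_le_bounded cK CG.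
have /C2P[cG [G1 [G2 [dG1 dG2 cG1 cG2]]]] := CG.
move: leB => /(c2_leP _ _ dG1 dG2) leB.
have eps20 : 0 < eps / 2 by rewrite divr_gt0.
have [N0 hN0] := bern_set_coord_cvg cG eps20.
have /choice[N1 hN1] j := bern_set_coord_cvg (cG1 j) eps20.
have /choice[N2 hN2] (ij : 'I_n * 'I_n) := bern_set_coord_cvg (cG2 ij.1 ij.2) eps20.
(* the degree exceeds the threshold of every derivative; the first summand
   controls the factor (N + 1) / (N + 2) of second differences *)
pose N := (Num.bound (2 * B / eps) + N0 + \sum_j N1 j + \sum_ij N2 ij).+1.
have NB : 2 * B / eps <= N.+2%:R.
  have c0 : 0 <= 2 * B / eps.
    by apply: divr_ge0; [apply: mulr_ge0 => //; exact: ltW|exact: ltW].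
  apply: (le_trans (ltW (archi_boundP c0))); rewrite ler_nat /N.
  by do 3 apply: leqW; rewrite -!addnA leq_addr.
have NN0 : (N0 < N)%N.
  by rewrite /N ltnS -!addnA addnCA leq_addr.
have NN1 j : (N1 j < N)%N.
  have le1 : (N1 j <= \sum_j N1 j)%N by rewrite (bigD1 j)//= leq_addr.
  by rewrite /N ltnS; apply: leq_trans le1 _; rewrite -addnA addnCA leq_addr.
have NN2 ij : (N2 ij < N)%N.
  have le2 : (N2 ij <= \sum_ij N2 ij)%N by rewrite (bigD1 ij)//= leq_addr.
  by rewrite /N ltnS; apply: leq_trans le2 _; rewrite addnC leq_addr.
have N_gt0 : (0 < N)%N by [].
clearbody N.
have grid M k : (k <= M)%N -> (0 < M)%N -> 0 <= x_ M k <= 1 /\ `|x_ M k - k%:R / M%:R| <= 2 / M%:R.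
  move=> kM M0; have MR : 0 < M%:R :> R by rewrite ltr0n.
  rewrite subrr normr0 !divr_ge0//=; split=> //.
  by rewrite ler_pdivrMr// mul1r ler_nat.
exists N.+2.
pose dF1 (j : 'I_n) z := if l (e j) == 0
  then bern N.+2 (fun k => G1 j (set_coord (x_ N.+2 k) z)) (s z)
  else a * N.+2%:R * bern N.+1 (fun k => G (set_coord (x_ N.+2 k.+1) z)
         - G (set_coord (x_ N.+2 k) z)) (s z).
pose dF2 (i j : 'I_n) z := if l (e j) == 0
  then if l (e i) == 0
    then bern N.+2 (fun k => G2 i j (set_coord (x_ N.+2 k) z)) (s z)
    else a * N.+2%:R * bern N.+1 (fun k => G1 j (set_coord (x_ N.+2 k.+1) z)
         - G1 j (set_coord (x_ N.+2 k) z)) (s z)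
  else if l (e i) == 0
    then a * N.+2%:R * bern N.+1 (fun k => G1 i (set_coord (x_ N.+2 k.+1) z)
         - G1 i (set_coord (x_ N.+2 k) z)) (s z)
    else a * N.+2%:R * (a * N.+1%:R * bern N (fun k =>
      (G (set_coord (x_ N.+2 k.+2) z) - G (set_coord (x_ N.+2 k.+1) z))
      - (G (set_coord (x_ N.+2 k.+1) z) - G (set_coord (x_ N.+2 k) z))) (s z)).
have ew j : l (e j) != 0 -> e j = w by case: (l_e j) => [->|->//]; rewrite eqxx.
have d1 j z : is_derive z (e j) (fun z =>
    bern N.+2 (fun k => G (set_coord (x_ N.+2 k) z)) (s z) - G z)
    (dF1 j z - G1 j z).
  apply: is_deriveB; rewrite /dF1; have [lj|/ew ->] := eqVneq (l (e j)) 0.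
    exact: (bern_derive_along N.+2 (x_ N.+2) lj (dG1 j)).
  exact: bern_derive_across.
have d2 i j z : is_derive z (e i) (fun z => dF1 j z - G1 j z) (dF2 i j z - G2 i j z).
  apply: is_deriveB; rewrite /dF1 /dF2.
  have [lj|ljw] := eqVneq (l (e j)) 0; have [li|liw] := eqVneq (l (e i)) 0.
  - exact: (bern_derive_along N.+2 (x_ N.+2) li (dG2 i j)).
  - by rewrite (ew i liw); exact: bern_derive_across.
  - exact: (bern_derive_along2 N.+1 (x_ N.+2) _ li (dG1 i)).
  - by rewrite (ew i liw); exact: bern_derive_across2.
have sym i j z : G2 i j z = G2 j i z.
  exact: (schwarz (dG1 j) (dG1 i) (dG2 i j) (dG2 j i) (@cG2 i j z) (@cG2 j i z)).
have half : eps / 2 <= eps by lra.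
have mixed i j z : K z -> l (e i) != 0 -> `|a * N.+2%:R * bern N.+1 (fun k =>
    G1 j (set_coord (x_ N.+2 k.+1) z) - G1 j (set_coord (x_ N.+2 k) z)) (s z)
    - G2 i j z| <= eps.
  move=> Kz /ew ei; have dw y : is_derive y w (G1 j) (G2 i j y) by rewrite -ei.
  have [xi -> hxi] := bern_first_difference N z dw.
  rewrite (le_trans _ half)//; apply: (hN2 (i, j) _ _ _ _ Kz hxi).
  exact: leqW.
apply/(c2_leP _ _ d1 d2) => z Kz; split=> [|j|i j].
- rewrite (le_trans _ half)//; apply: hN0 => // [|k kN]; first by do 2 apply: leqW.
  exact: grid.
- rewrite /dF1; have [lj|ljw] := eqVneq (l (e j)) 0.
    rewrite (le_trans _ half)//; apply: (hN1 j) => // [|k kN]; first by do 2 apply: leqW.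
    exact: grid.
  have dw y : is_derive y w G (G1 j y) by rewrite -(ew j ljw).
  have [xi -> hxi] := bern_first_difference N z dw.
  rewrite (le_trans _ half)//; apply: (hN1 j _ _ _ _ Kz hxi).
  exact: leqW.
- rewrite /dF2; have [lj|ljw] := eqVneq (l (e j)) 0; have [li|liw] := eqVneq (l (e i)) 0.
  + rewrite (le_trans _ half)//; apply: (hN2 (i, j)) => // [|k kN].
      by do 2 apply: leqW.
    exact: grid.
  + exact: mixed.
  + by rewrite sym; exact: mixed.
  + have dw y : is_derive y w G (G1 j y) by rewrite -(ew j ljw).
    have dww y : is_derive y w (G1 j) (G2 i j y) by rewrite -(ew i liw).
    have [xi -> hxi] := bern_second_difference z N_gt0 dw dww.
    have hb := hN2 (i, j) N (NN2 _) xi z Kz hxi.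
    have [_ _ /(_ i j) gB] := leB z Kz.
    move: hb gB; rewrite /=; move: (bern _ _ _) (G2 i j z) => b g hb gB.
    have N2R : 0 < N.+2%:R :> R by rewrite ltr0n.
    set t := (X in `|X|).
    have -> : t = (1 - 1 / N.+2%:R) * (b - g) - g / N.+2%:R.
      by rewrite /t; move: N2R; rewrite -[N.+2%:R]natr1; move: (N.+1%:R) => q q0; field; rewrite gt_eqF.
    have q0 : 0 <= (1 / N.+2%:R : R) <= 1.
      by rewrite divr_ge0//= ler_pdivrMr// mul1r ler1n.
    have gN : `|g / N.+2%:R| <= eps / 2.
      rewrite normrM normfV (gtr0_norm N2R) ler_pdivrMr// (le_trans gB)//.
      by move: NB; rewrite ler_pdivrMr//; lra.
    rewrite (le_trans (ler_normB _ _))// (splitr eps) lerD// normrM.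
    move: q0 => /andP[]; move: (1 / _) => q q0 q1.
    rewrite ger0_norm ?subr_ge0// (le_trans _ hb)// ler_piMl//; lra.
Qed.

End coordinate.

(** * Approximation of functions that are C^2 in the state, one coordinate at a time *)

Section every_C2_function_is_approximable.
Context (R : realType) (n : nat).
Notation Z := (R * 'cV[R]_n)%type.

Definition ydir (j : 'I_n) : Z := (0, delta_mx j 0).

Definition box (T A : R) : set Z :=
  [set z : Z | 0 <= z.1 <= T /\ forall j : 'I_n, - A <= z.2 j 0 <= A].

Lemma trmx_continuous m p : continuous (@trmx R m p).
Proof.
move=> u A /nbhs_ballP[d /= d0 dA].
apply/nbhs_ballP; exists d => //= v [_ uv]; apply: dA; split => // i j.
by rewrite !mxE; exact: uv.
Qed.

Lemma box_compact T A : compact (box T A).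
Proof.
have -> : box T A = `[0, T] `*` (trmx @` [set v : 'rV[R]_n | forall j, `[- A, A]%classic (v ord0 j)]).
  apply/seteqP; split=> [z [zT zA]|z [zT [v vA zv]]].
    split; first by rewrite /= in_itv.
    exists z.2^T; last by rewrite trmxK.
    by move=> j; rewrite /= in_itv /= mxE.
  split; first by move: zT; rewrite /= in_itv.
  by move=> j; have := vA j; rewrite /= in_itv /= -zv mxE.
apply: compact_setX; first exact: segment_compact.
apply: continuous_compact; first exact/continuous_subspaceT/trmx_continuous.
by apply: (@rV_compact _ _ (fun=> `[- A, A]%classic)) => _; exact: segment_compact.
Qed.

Lemma time_continuous : continuous (fun z : Z => z.1).
Proof. by move=> z; exact: cvg_fst. Qed.

Lemma coord_y_continuous j : continuous (fun z : Z => z.2 j 0).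
Proof.
move=> z; apply: (@continuous_comp _ _ _ snd (fun y : 'cV[R]_n => y j 0)).
  exact: cvg_snd.
exact: coord_continuous.
Qed.

Context (T A : R) (sigma sigma1 sigma2 : R -> R) (b : R) (N : set (set (Z -> R))).
Hypothesis T_gt0 : 0 < T.
Hypothesis A_gt0 : 0 < A.
Hypothesis Nsys : neuron_system ydir sigma N.
Hypothesis Ntime : forall S, N S -> S (fun z => z.1).
Hypothesis Ncoord : forall S j, N S -> S (fun z => z.2 j 0).
Hypothesis dsigma : forall u : R, is_derive u 1 sigma (sigma1 u).
Hypothesis dsigma1 : forall u : R, is_derive u 1 sigma1 (sigma2 u).
Hypothesis csigma2 : continuous sigma2.
Hypothesis sigma2b : sigma2 b != 0.

Notation app := (approximable ydir (box T A) N).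

Lemma approximable_mul F G : app F -> app G -> app (fun z => F z * G z).
Proof.
move=> aF aG.
exact: (approximableM Nsys (@box_compact T A) dsigma dsigma1 csigma2 sigma2b aF aG).
Qed.

Lemma approximable_time : app (fun z => z.1).
Proof.
apply: approximable_all => [|S NS]; last exact: Ntime.
exact: (Ck_along_affine _ _ time_continuous (l := fun z => z.1)).
Qed.

Lemma approximable_coord j : app (fun z => z.2 j 0).
Proof.
apply: approximable_all => [|S NS]; last exact: Ncoord.
have lin h (x v : Z) : (h *: v + x).2 j 0 = h * v.2 j 0 + x.2 j 0.
  by rewrite /= !mxE.
exact: (Ck_along_affine _ _ (@coord_y_continuous j) lin).
Qed.

Lemma approximable_bern M (c : nat -> Z -> R) s : (forall k, app (c k)) -> app s ->
  app (fun z => bern M (c^~ z) (s z)).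
Proof.
move=> hc hs; elim: M c hc => [|M IH] c hc; first exact: hc.
have h1 : app (fun z => 1 - s z).
  have -> : (fun z => 1 - s z) = (fun z => 1 + (-1) * s z).
    by apply/funext => z; rewrite mulN1r.
  exact: (approximableD Nsys (approximable_cst _ Nsys 1) (approximableZ Nsys (-1) hs)).
apply: (approximableD Nsys (approximable_mul h1 (IH c hc))).
exact: (approximable_mul hs (IH _ (fun k => hc k.+1))).
Qed.

(** The Bernstein coefficients are [G] with its coordinate frozen at the nodes. *)
Lemma approximable_coordwise (w : Z) a (l s : Z -> R) G :
  0 < a -> (forall h v z, s (h *: v + z) = h * l v + s z) ->
  l w = a -> (forall j, l (ydir j) = 0 \/ ydir j = w) ->
  (forall z, box T A z -> 0 <= s z <= 1) ->
  (forall x z, 0 <= x <= 1 -> box T A z -> box T A (set_coord w a s x z)) ->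
  app s -> C2 ydir G -> (forall x, app (fun z => G (set_coord w a s x z))) ->
  app G.
Proof.
move=> a0 sl lw lj s01 sK aps CG hG.
apply: (approximable_lim Nsys CG) => eta eta0.
have [M hM] := bern_c2_cvg a0 sl lw lj (@box_compact T A) s01 sK CG eta0.
exists (fun z => bern M (fun k => G (set_coord w a s (k%:R / M%:R) z)) (s z)).
  exact: (approximable_bern M (fun k => hG (k%:R / M%:R)) aps).
exact: hM.
Qed.

Definition first_coords m (G : Z -> R) := forall z z' : Z, z.1 = z'.1 ->
  (forall j : 'I_n, (j < m)%N -> z.2 j 0 = z'.2 j 0) -> G z = G z'.

Lemma time_only_approximable G : C2 ydir G -> first_coords 0 G -> app G.
Proof.
move=> CG hG; have iT0 : 0 < T^-1 by rewrite invr_gt0.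
have sE : forall h (v z : Z), T^-1 * (h *: v + z).1 = h * (T^-1 * v.1) + T^-1 * z.1.
  by move=> h v z; rewrite /= mulrDr mulrCA.
have scE x z : set_coord ((1, 0) : Z) T^-1 (fun z : Z => T^-1 * z.1) x z = (x * T, z.2).
  rewrite /set_coord; congr pair => /=; last by rewrite scaler0 add0r.
  by rewrite [_ *: 1]mulr1; field; rewrite gt_eqF.
apply: (approximable_coordwise (w := (1, 0)) iT0 sE _ _ _ _ _ CG).
- by rewrite /= mulr1.
- by move=> j; left; rewrite /= mulr0.
- by move=> z [/andP[z0 zT] _]; rewrite mulr_ge0 ?(ltW iT0)//= mulrC ler_pdivrMr// mul1r.
- move=> x z /andP[x0 x1] [_ zA]; rewrite scE; split=> //=.
  by rewrite mulr_ge0 ?(ltW T_gt0)//= ler_piMl// ltW.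
- exact: (approximableZ Nsys _ approximable_time).
- move=> x; have -> : (fun z => G (set_coord ((1, 0) : Z) T^-1 (fun z : Z => T^-1 * z.1) x z)) =
      (fun=> G (x * T, 0)).
    by apply/funext => z; rewrite scE; apply: hG.
  exact: (approximable_cst _ Nsys).
Qed.

(** Freezing the last coordinate on which [G] depends leaves a function of fewer
coordinates. *)
Lemma first_coords_approximable m G : C2 ydir G -> first_coords m G -> app G.
Proof.
elim: m G => [|m IH] G CG hG; first exact: time_only_approximable.
have [mn|nm] := ltnP m n; last first.
  apply: (IH _ CG) => z z' t zz'; apply: (hG _ _ t) => j _; apply: zz'.
  exact: leq_trans (ltn_ord j) nm.
pose i := Ordinal mn; pose a := (2 * A)^-1.
have A20 : 0 < 2 * A by rewrite mulr_gt0.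
have a0 : 0 < a by rewrite invr_gt0.
pose l (z : Z) := a * z.2 i 0; pose s (z : Z) := a * z.2 i 0 + 2^-1.
have cs : continuous s.
  move=> z; apply: cvgD; last exact: cvg_cst.
  by apply: cvgMl_tmp; exact: coord_y_continuous.
have sE h (v z : Z) : s (h *: v + z) = h * l v + s z.
  by rewrite /s /l /= !mxE; ring.
have lE j : l (ydir j) = a * (j == i)%:R by rewrite /l /= mxE eqxx andbT eq_sym.
have scE x z : set_coord (ydir i) a s x z =
    (z.1, \col_j (if j == i then A * (2 * x - 1) else z.2 j 0)).
  rewrite /set_coord; congr pair => /=; first by rewrite scaler0 add0r.
  apply/colP => j; rewrite !mxE eqxx andbT; case: eqP => [->|_] /=; last first.
    by rewrite mulr0 add0r.
  by rewrite /s /a mulr1; field; rewrite gt_eqF.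
have lw : l (ydir i) = a by rewrite lE eqxx mulr1.
have lj j : l (ydir j) = 0 \/ ydir j = ydir i.
  have [->|ji] := eqVneq j i; first by right.
  by left; rewrite lE (negbTE ji) mulr0.
apply: (approximable_coordwise a0 sE lw lj _ _ _ CG).
- move=> z [_ /(_ i)/andP[z0 z1]]; rewrite /s.
  have e1 : a * (2 * A) = 1 by rewrite mulVf// gt_eqF.
  by apply/andP; split; nra.
- move=> x z /andP[x0 x1] [zT zA]; rewrite scE; split=> // j; rewrite mxE.
  case: eqP => // _; apply/andP; split; nra.
- apply: (approximableD Nsys (approximableZ Nsys a (approximable_coord i))).
  exact: (approximable_cst _ Nsys).
- move=> x; apply: IH; first exact: (C2_set_coord a0 sE cs lw lj x CG).
  move=> z z' t zz'; rewrite !scE; apply: hG; first exact: t.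
  move=> j jm; rewrite /= !mxE.
  case: eqP => // /eqP ji; apply: zz'; rewrite ltn_neqAle -ltnS jm andbT.
  exact: ji.
Qed.

Lemma C2_approximable G : C2 ydir G -> app G.
Proof.
move=> CG; apply: (@first_coords_approximable n _ CG) => -[t y] [t' y'] /= -> yy'.
by congr (G (_, _)); apply/colP => j; exact: yy'.
Qed.

End every_C2_function_is_approximable.

(** * Functions read off the hidden layers of a network *)

Section network_spaces.
Context (R : realType) (sigma : R -> R).

(** Feature maps computed by stacks of hidden layers.  They grow at the output
side, whereas [net] consumes its parameters from the input side. *)
Inductive hidden (d : nat) : forall w, ('cV[R]_d -> 'cV[R]_w) -> Prop :=
| hidden_input : hidden id
| hidden_layer w w' (Phi : 'cV[R]_d -> 'cV[R]_w) (W1 W2 : 'M[R]_(w', w)) b :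
    (0 < w')%N -> hidden Phi ->
    hidden (fun x => map_mx sigma (W1 *m Phi x + b) + W2 *m Phi x).

(** Continuation form of the correspondence between the two orders of recursion:
any network can be placed behind a stack of hidden layers. *)
Lemma hidden_net d w (Phi : 'cV[R]_d -> 'cV[R]_w) : hidden Phi ->
  forall ws' (theta' : net_param R w ws'), all (leq 1) ws' ->
  exists ws (theta : net_param R d ws), [/\ all (leq 1) ws,
    (size ws' <= size ws)%N &
    forall x, net sigma theta x = net sigma theta' (Phi x)].
Proof.
elim=> [|{}w w' {}Phi W1 W2 b w'0 _ IH] ws' theta' ws'0.
  by exists ws', theta'.
have [|ws [theta [ws0 sz eq_net]]] :=
  IH (w' :: ws') ((W1, W2, b, theta') : net_param R w (w' :: ws')).
  by rewrite /= w'0.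
by exists ws, theta; split=> //; exact: leq_trans sz.
Qed.

(** The skip connection copies all features up to the constant [sigma 0], and one
neuron is appended. *)
Lemma append_neuronE w (c : 'rV[R]_w) (r : R) (p : 'cV[R]_w) :
  map_mx sigma (col_mx 0 c *m p + col_mx 0 r%:M) + col_mx 1%:M 0 *m p =
  col_mx (p + const_mx (sigma 0)) (sigma ((c *m p) 0 0 + r))%:M.
Proof.
rewrite !mul_col_mx add_col_mx map_col_mx add_col_mx !mul0mx.
rewrite mul1mx; congr col_mx.
  by rewrite addr0 addrC; congr (_ + _); apply/matrixP => i j; rewrite !mxE.
by rewrite addr0; apply/matrixP => i j; rewrite !ord1 !mxE mulr1n.
Qed.

Lemma hidden_append d w (Phi : 'cV[R]_d -> 'cV[R]_w) (c : 'rV[R]_w) (r : R) :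
  hidden Phi -> hidden (fun x => col_mx (Phi x + const_mx (sigma 0))
                                   (sigma ((c *m Phi x) 0 0 + r))%:M).
Proof.
move=> hPhi; under eq_fun do rewrite -append_neuronE.
by apply: hidden_layer hPhi; rewrite addn1.
Qed.

Context (n : nat).
Notation Z := (R * 'cV[R]_n)%type.

Definition net_input (z : Z) : 'cV[R]_(1 + n) := col_mx z.1%:M z.2.

Definition readouts w (Phi : 'cV[R]_(1 + n) -> 'cV[R]_w) : set (Z -> R) :=
  [set F | exists (c : 'rV[R]_w) r, forall z, F z = (c *m Phi (net_input z)) 0 0 + r].

(** Time and state are required among the readouts because the hidden layers need
not preserve them. *)
Definition network_space (S : set (Z -> R)) : Prop :=
  [/\ exists w (Phi : 'cV[R]_(1 + n) -> 'cV[R]_w), hidden Phi /\ S = readouts Phi,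
      S (fun z => z.1) & forall j, S (fun z => z.2 j 0)].

Lemma network_space_input : network_space (readouts id).
Proof.
split; first by exists (1 + n)%N, id; split=> //; exact: hidden_input.
  exists (row_mx 1%:M 0), 0 => z.
  by rewrite /net_input mul_row_col mul1mx mul0mx !addr0 mxE mulr1n.
move=> j; exists (row_mx 0 (delta_mx 0 j)), 0 => z.
rewrite /net_input mul_row_col mul0mx add0r addr0 -rowE mxE.
by [].
Qed.

(** Affine readouts absorb the shift by [sigma 0] of the copied features. *)
Lemma network_space_neuron S F : network_space S -> S F ->
  exists S', [/\ network_space S', S `<=` S' & S' (fun z => sigma (F z))].
Proof.
move=> [[w [Phi [hPhi ->]]] St Sy] [c [r Fcr]].
have := hidden_append c r hPhi; set Phi' := (X in hidden X) => hPhi'.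
have sub : readouts Phi `<=` readouts Phi'.
  move=> F' [c' [r' F'E]].
  exists (row_mx c' 0), (r' - (c' *m (const_mx (sigma 0) : 'cV[R]_w)) 0 0) => z.
  rewrite mul_row_col mul0mx addr0 mulmxDr F'E [in RHS]mxE.
  by rewrite addrACA subrr addr0.
exists (readouts Phi'); split=> //.
  split; [by exists (w + 1)%N, Phi'|exact: sub|by move=> j; exact: sub].
exists (row_mx 0 1%:M), 0 => z.
by rewrite mul_row_col mul0mx add0r mul1mx addr0 mxE mulr1n Fcr.
Qed.

Lemma hidden_smooth k w (Phi : 'cV[R]_(1 + n) -> 'cV[R]_w) (E : set Z) :
  Ck_along [set (1 : R)] k sigma -> hidden Phi ->
  forall i, Ck_along E k (fun z => Phi (net_input z) i 0).
Proof.
move=> Cs; elim=> [i|{}w w' {}Phi W1 W2 b _ _ IH i].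
  have -> : (fun z => net_input z i 0) =
      (fun z : Z => match fintype.split i with inl _ => z.1 | inr j => z.2 j 0 end).
    apply/funext => z; rewrite /net_input mxE; case: (fintype.split i) => // j.
    by rewrite !ord1 mxE mulr1n.
  case: (fintype.split i) => j.
    exact: (Ck_along_affine _ _ (@time_continuous R n) (l := fun z => z.1)).
  have lin h (x v : Z) : (h *: v + x).2 j 0 = h * v.2 j 0 + x.2 j 0.
    by rewrite /= !mxE.
  exact: (Ck_along_affine _ _ (@coord_y_continuous R n j) lin).
have lin (W : 'M[R]_(w', w)) : Ck_along E k (fun z => (W *m Phi (net_input z)) i 0).
  have -> : (fun z => (W *m Phi (net_input z)) i 0) =
      (fun z => \sum_j W i j * Phi (net_input z) j 0).
    by apply/funext => z; rewrite mxE.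
  by apply: Ck_along_sum => j; exact: (Ck_alongZ (W i j) (IH j)).
have -> : (fun z => (map_mx sigma (W1 *m Phi (net_input z) + b)
                     + W2 *m Phi (net_input z)) i 0) =
   (fun z => sigma ((W1 *m Phi (net_input z)) i 0 + b i 0) + (W2 *m Phi (net_input z)) i 0).
  by apply/funext => z; rewrite [LHS]mxE; congr (_ + _); rewrite mxE; congr sigma; rewrite mxE.
apply: (Ck_alongD _ (lin W2)).
exact: (Ck_along_comp Cs (Ck_alongD (lin W1) (Ck_along_cst E k (b i 0)))).
Qed.

Lemma network_space_system : Ck_along [set (1 : R)] 2 sigma ->
  neuron_system (@ydir R n) sigma network_space.
Proof.
move=> Cs; split.
- move=> S F [[w [Phi [hPhi ->]]] _ _] [c [r FE]].
  have -> : F = (fun z => \sum_j c 0 j * Phi (net_input z) j 0 + r).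
    by apply/funext => z; rewrite FE mxE.
  apply: (Ck_alongD _ (Ck_along_cst _ 2 r)); apply: Ck_along_sum => j.
  exact: (Ck_alongZ _ (hidden_smooth _ Cs hPhi j)).
- move=> S c [[w [Phi [_ ->]]] _ _]; exists 0, c => z.
  by rewrite mul0mx mxE add0r.
- move=> S F G a b [[w [Phi [_ ->]]] _ _] [c [r FE]] [c' [r' GE]].
  exists (a *: c + b *: c'), (a * r + b * r') => z.
  by rewrite FE GE mulmxDl -!scalemxAl !mxE; ring.
- exact: network_space_neuron.
Qed.

Lemma network_space_net S F b : sigma b != 0 -> network_space S -> S F ->
  exists ws (theta : net_param R (1 + n) ws), architecture ws /\
    forall z, F z = net sigma theta (net_input z).
Proof.
move=> sb [[w [Phi [hPhi ->]]] _ _] [c [r FE]].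
(* the last neuron is the nonzero constant sigma b, which makes up for the
   missing bias of the output layer *)
pose q := (r - (c *m (const_mx (sigma 0) : 'cV[R]_w)) 0 0) / sigma b.
have w1 : all (leq 1) [:: (w + 1)%N] by rewrite /= addn1.
have [ws [theta [ws0 sz eq_net]]] := hidden_net hPhi
  ((col_mx 0 0, col_mx 1%:M 0, col_mx 0 b%:M, row_mx c q%:M) :
    net_param R w [:: (w + 1)%N]) w1.
exists ws, theta; split.
  by split=> // ws_nil; move: sz; rewrite ws_nil.
move=> z; rewrite eq_net /= append_neuronE FE.
rewrite mul_row_col mulmxDr mul0mx -scalar_mxM.
rewrite [RHS]mxE [X in _ = X + _]mxE [X in _ = _ + X]mxE mulr1n [X in q * sigma (X + b)]mxE add0r.
by rewrite /q divfK// -addrA [X in _ = _ + X]addrC subrK.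
Qed.

End network_spaces.

(** * Smoothness of a network in its parameters and input *)

Section smoothness_of_networks.
Context (R : realType) (sigma : R -> R) (U : normedModType R) (E : set U) (k : nat).
Hypothesis sigma_smooth : Ck_along [set (1 : R)] k sigma.

(** Entrywise smoothness, by recursion on the nested product of parameter
spaces. *)
Fixpoint smooth_param (d : nat) (ws : seq nat) : (U -> net_param R d ws) -> Prop :=
  match ws return (U -> net_param R d ws) -> Prop with
  | [::] => fun Theta => forall j, Ck_along E k (fun u => Theta u 0 j)
  | w :: ws' => fun Theta =>
    [/\ forall i j, Ck_along E k (fun u => (Theta u).1.1.1 i j),
        forall i j, Ck_along E k (fun u => (Theta u).1.1.2 i j),
        forall i, Ck_along E k (fun u => (Theta u).1.2 i 0)
      & @smooth_param w ws' (fun u => (Theta u).2)]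
  end.

Lemma smooth_mulmx d w (W : U -> 'M[R]_(w, d)) (X : U -> 'cV[R]_d) :
  (forall i j, Ck_along E k (fun u => W u i j)) ->
  (forall j, Ck_along E k (fun u => X u j 0)) ->
  forall i, Ck_along E k (fun u => (W u *m X u) i 0).
Proof.
move=> sW sX i.
have -> : (fun u => (W u *m X u) i 0) = (fun u => \sum_j W u i j * X u j 0).
  by apply/funext => u; rewrite mxE.
by apply: Ck_along_sum => j; exact: (Ck_alongM (sW i j) (sX j)).
Qed.

Lemma smooth_net ws d (Theta : U -> net_param R d ws) (X : U -> 'cV[R]_d) :
  smooth_param Theta -> (forall i, Ck_along E k (fun u => X u i 0)) ->
  Ck_along E k (fun u => net sigma (Theta u) (X u)).
Proof.
elim: ws d Theta X => [|w ws IH] d Theta X.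
  move=> sT sX; apply: smooth_mulmx => // i j.
  by have := sT j; rewrite ord1.
move=> [s1 s2 sb sT] sX.
have -> : (fun u => net sigma (Theta u) (X u)) = (fun u => net sigma (Theta u).2
    (map_mx sigma ((Theta u).1.1.1 *m X u + (Theta u).1.2) + (Theta u).1.1.2 *m X u)).
  by apply/funext => u /=; case: (Theta u) => [[[W1 W2] b] th].
apply: IH => // i.
have -> : (fun u => (map_mx sigma ((Theta u).1.1.1 *m X u + (Theta u).1.2)
      + (Theta u).1.1.2 *m X u) i 0) =
   (fun u => sigma (((Theta u).1.1.1 *m X u) i 0 + (Theta u).1.2 i 0)
      + ((Theta u).1.1.2 *m X u) i 0).
  by apply/funext => u; rewrite [LHS]mxE; congr (_ + _); rewrite mxE; congr sigma; rewrite mxE.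
apply: (Ck_alongD _ (smooth_mulmx s2 sX i)).
exact: (Ck_along_comp sigma_smooth (Ck_alongD (smooth_mulmx s1 sX i) (sb i))).
Qed.

Definition continuous_linear (W : normedModType R) (L : U -> W) :=
  continuous L /\ forall h x v, L (h *: v + x) = h *: L v + L x.

Lemma linear_fst (V W : normedModType R) (L : U -> V * W) :
  continuous_linear L -> continuous_linear (fun u => (L u).1).
Proof.
move=> [cL lL]; split=> [u|h x v]; last by rewrite lL.
by apply: (@continuous_comp _ _ _ L fst); [exact: cL|exact: cvg_fst].
Qed.

Lemma linear_snd (V W : normedModType R) (L : U -> V * W) :
  continuous_linear L -> continuous_linear (fun u => (L u).2).
Proof.
move=> [cL lL]; split=> [u|h x v]; last by rewrite lL.
by apply: (@continuous_comp _ _ _ L snd); [exact: cL|exact: cvg_snd].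
Qed.

Lemma smooth_coord m p (L : U -> 'M[R]_(m, p)) i j :
  continuous_linear L -> Ck_along E k (fun u => L u i j).
Proof.
move=> [cL lL].
have cf : continuous (fun u => L u i j).
  move=> u; apply: (@continuous_comp _ _ _ L (fun M : 'M[R]_(m, p) => M i j)).
    exact: cL.
  exact: coord_continuous.
have lin h (x v : U) : L (h *: v + x) i j = h * L v i j + L x i j.
  by rewrite lL !mxE.
exact: (Ck_along_affine _ _ cf lin).
Qed.

Lemma linear_smooth_param ws d (Theta : U -> net_param R d ws) :
  continuous_linear Theta -> smooth_param Theta.
Proof.
elim: ws d Theta => [|w ws IH] d Theta lT; first by move=> j; exact: smooth_coord.
have l1 := linear_fst (linear_fst lT).
split=> [i j|i j|i|].
- exact: (smooth_coord _ _ (linear_fst l1)).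
- exact: (smooth_coord _ _ (linear_snd l1)).
- exact: (smooth_coord _ _ (linear_snd (linear_fst lT))).
- exact: IH (linear_snd lT).
Qed.

End smoothness_of_networks.

Section smoothness_of_net_value.
Context (R : realType) (n : nat) (T : R) (Q2 : 'M[R]_n) (ydT : 'cV[R]_n).

Lemma enorm_sqr m (v : 'cV[R]_m) : enorm v ^+ 2 = \sum_i v i 0 ^+ 2.
Proof. by rewrite sqr_sqrtr// sumr_ge0// => i _; exact: sqr_ge0. Qed.

Lemma smooth_terminal_cost (U : normedModType R) (E : set U) k (Y : U -> 'cV[R]_n) :
  (forall j, Ck_along E k (fun u => Y u j 0)) ->
  Ck_along E k (fun u => terminal_cost Q2 ydT (Y u)).
Proof.
move=> sY.
have -> : (fun u => terminal_cost Q2 ydT (Y u)) =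
    (fun u => 2^-1 * \sum_i (Q2 *m (Y u - ydT)) i 0 * (Q2 *m (Y u - ydT)) i 0).
  apply/funext => u; rewrite /terminal_cost enorm_sqr.
  by under eq_bigr do rewrite expr2.
apply: Ck_alongZ; apply: Ck_along_sum => i.
have s1 : Ck_along E k (fun u => (Q2 *m (Y u - ydT)) i 0).
  apply: smooth_mulmx => [i' j|j]; first exact: Ck_along_cst.
  have -> : (fun u => (Y u - ydT) j 0) = (fun u => Y u j 0 - ydT j 0).
    by apply/funext => u; rewrite !mxE.
  exact: (Ck_alongB (sY j) (Ck_along_cst E k (ydT j 0))).
exact: (Ck_alongM s1 s1).
Qed.

Lemma net_value_smooth sigma ws k : Ck k sigma ->
  Ck k (fun p : net_param R (1 + n) ws * (R * 'cV[R]_n) =>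
          net_value T Q2 ydT sigma p.1 p.2).
Proof.
move=> Csigma; apply: Ck_of_along.
set U := (net_param R (1 + n) ws * (R * 'cV[R]_n))%type.
have Cs := Ck_along_of [set (1 : R)] Csigma.
have lid : continuous_linear (fun p : U => p).
  by split=> // p; exact: cvg_id.
have lz := linear_snd lid.
have sT : smooth_param setT k (fun p : U => p.1).
  exact: (linear_smooth_param _ _ (linear_fst lid)).
have sy j : Ck_along setT k (fun p : U => p.2.2 j 0).
  exact: (smooth_coord _ _ _ _ (linear_snd lz)).
have st : Ck_along setT k (fun p : U => p.2.1).
  have [ct lt] := linear_fst lz; exact: (Ck_along_affine _ _ ct lt).
have sinput (t : U -> R) : Ck_along setT k t ->
    forall i, Ck_along setT k (fun p : U => (col_mx (t p)%:M p.2.2) i 0).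
  move=> s i.
  have -> : (fun p : U => col_mx (t p)%:M p.2.2 i 0) =
      (fun p => match fintype.split i with inl _ => t p | inr j => p.2.2 j 0 end).
    apply/funext => p; rewrite mxE; case: (fintype.split i) => // j.
    by rewrite !ord1 mxE mulr1n.
  by case: (fintype.split i) => j; [exact: s|exact: sy].
apply: Ck_alongB.
  apply: (Ck_alongD (smooth_terminal_cost sy)).
  exact: (smooth_net Cs sT (sinput _ st)).
exact: (smooth_net Cs sT (sinput _ (Ck_along_cst _ _ T))).
Qed.

End smoothness_of_net_value.

(** * The cylinder [0, T] x ball *)

Section cylinder.
Context (R : realType) (n : nat) (T r : R).
Hypothesis T_gt0 : 0 < T.
Hypothesis r_gt0 : 0 < r.
Notation Z := (R * 'cV[R]_n)%type.

Definition sqnorm (y : 'cV[R]_n) : R := \sum_i y i 0 ^+ 2.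

Definition cylinder : set Z := `[0, T] `*` [set y | enorm y <= r].

Lemma sqnorm_ge0 y : 0 <= sqnorm y.
Proof. by apply: sumr_ge0 => i _; exact: sqr_ge0. Qed.

Lemma sqnormZ a y : sqnorm (a *: y) = a ^+ 2 * sqnorm y.
Proof. by rewrite /sqnorm mulr_sumr; apply: eq_bigr => i _; rewrite mxE exprMn. Qed.

Lemma enorm_le y : (enorm y <= r) = (sqnorm y <= r ^+ 2).
Proof.
rewrite -(ler_pXn2r (n := 2))// ?nnegrE ?sqrtr_ge0//; last exact: ltW.
by rewrite enorm_sqr.
Qed.

Lemma cylinderE z : cylinder z <-> 0 <= z.1 <= T /\ sqnorm z.2 <= r ^+ 2.
Proof. by rewrite /cylinder /= in_itv /= enorm_le. Qed.

Lemma sqnorm_smooth (E : set Z) k : Ck_along E k (fun z : Z => sqnorm z.2).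
Proof.
apply: Ck_along_sum => i.
have lin h (x v : Z) : (h *: v + x).2 i 0 = h * v.2 i 0 + x.2 i 0.
  by rewrite /= !mxE.
have s1 := Ck_along_affine E k (@coord_y_continuous R n i) lin.
have -> : (fun z : Z => z.2 i 0 ^+ 2) = (fun z => z.2 i 0 * z.2 i 0).
  by apply/funext => z; rewrite expr2.
exact: (Ck_alongM s1 s1).
Qed.

Lemma sqnorm_continuous : continuous (fun z : Z => sqnorm z.2).
Proof. exact: (Ck_along_continuous (sqnorm_smooth set0 0)). Qed.

Lemma coord_sqnorm (y : 'cV[R]_n) j : y j 0 ^+ 2 <= sqnorm y.
Proof.
by rewrite /sqnorm (bigD1 j)//= lerDl sumr_ge0// => i _; exact: sqr_ge0.
Qed.

Lemma cylinder_sub_box : cylinder `<=` box T r.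
Proof.
move=> z /cylinderE[zT zr]; split=> // j.
rewrite -ler_norml -(ler_pXn2r (n := 2))// ?nnegrE//; last exact: ltW.
by rewrite real_normK ?num_real// (le_trans (coord_sqnorm _ _)).
Qed.

Lemma cylinder_compact : compact cylinder.
Proof.
have -> : cylinder = box T r `&` [set z | sqnorm z.2 <= r ^+ 2].
  apply/seteqP; split=> z; first by move=> h; split; [exact: cylinder_sub_box|case/cylinderE: h].
  by move=> [[zT _] zr]; apply/cylinderE.
apply: compact_closedI; first exact: box_compact.
apply: (@closed_comp _ _ (fun z : Z => sqnorm z.2) [set x | x <= r ^+ 2]).
  by move=> z _; exact: sqnorm_continuous.
exact: closed_le.
Qed.

Lemma open_cylinder z : 0 < z.1 < T -> sqnorm z.2 < r ^+ 2 -> cylinder° z.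
Proof.
move=> /andP[z0 zT] zr.
have h1 : \forall x \near z, 0 < x.1 by exact: (cvgr_gt z.1 (@time_continuous R n z) _ z0).
have h2 : \forall x \near z, x.1 < T by exact: (cvgr_lt z.1 (@time_continuous R n z) _ zT).
have h3 : \forall x \near z, sqnorm x.2 < r ^+ 2.
  by exact: (cvgr_lt (sqnorm z.2) (@sqnorm_continuous z) _ zr).
near=> x; apply/cylinderE; split; last by apply: ltW; near: x.
by apply/andP; split; apply: ltW; near: x.
Unshelve. all: by end_near. Qed.

Lemma cylinder_interior z : cylinder° z <-> 0 < z.1 < T /\ sqnorm z.2 < r ^+ 2.
Proof.
split=> [/nbhs_ballP[d /= d0 hd]|[]]; last exact: open_cylinder.
have inK x : `|z - x| < d -> 0 <= x.1 <= T /\ sqnorm x.2 <= r ^+ 2.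
  by move=> zx; apply/cylinderE; apply: hd; rewrite -ball_normE.
have d20 : 0 < d / 2 by rewrite divr_gt0.
have d2d : d / 2 < d by rewrite ltr_pdivrMr// ltr_pMr// ltr1n.
split.
  have := inK (z.1 - d / 2, z.2); have := inK (z.1 + d / 2, z.2).
  rewrite !prod_normE /= subrr normr0 !opprD !opprK !addrA subrr !add0r normrN.
  rewrite (gtr0_norm d20) gt_max d2d d0 /= => /(_ isT)[/andP[? ?] _] /(_ isT)[/andP[? ?] _].
  by apply/andP; split; lra.
have ny : 0 < `|z.2| + 1 by rewrite ltr_wpDl.
pose k := d / 2 / (`|z.2| + 1).
have k0 : 0 < k by rewrite divr_gt0.
have := inK (z.1, (1 + k) *: z.2).
rewrite prod_normE /= subrr normr0 -[X in X - _]scale1r -scalerBl opprD addrA subrr add0r.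
rewrite normrZ normrN (gtr0_norm k0) gt_max d0 /=.
have -> : k * `|z.2| < d.
  rewrite (le_lt_trans _ d2d)// /k mulrAC ler_pdivrMr// ler_pM2l//.
  by rewrite lerDl.
move=> /(_ isT)[_]; rewrite sqnormZ => h.
have [->|y0] := eqVneq (sqnorm z.2) 0; first by rewrite exprn_gt0.
have q0 : 0 < sqnorm z.2 by rewrite lt_def y0 sqnorm_ge0.
by apply: lt_le_trans h; rewrite ltr_pMl// expr2; nra.
Qed.

Lemma cylinder_interior_dense z : cylinder z ->
  ProperFilter (within cylinder° (nbhs z)).
Proof.
move=> /cylinderE[/andP[z0 zT] zr].
apply: Build_ProperFilter_ex => P.
rewrite /within /= => /nbhs_ballP[d /= d0 hd].
pose c : Z := (T / 2, 0).
have nz : 0 < `|c - z| + 1 by rewrite ltr_wpDl.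
pose k := Num.min 1 (d / 2 / (`|c - z| + 1)).
have k0 : 0 < k by rewrite lt_min ltr01 !divr_gt0.
have k1 : k <= 1 by rewrite ge_min lexx.
have kd : k * `|c - z| < d.
  rewrite (@le_lt_trans _ _ (d / 2))//; last by rewrite ltr_pdivrMr// ltr_pMr// ltr1n.
  rewrite (@le_trans _ _ (d / 2 / (`|c - z| + 1) * `|c - z|))//.
    by rewrite ler_wpM2r// ge_min lexx orbT.
  by rewrite mulrAC ler_pdivrMr// ler_pM2l ?divr_gt0// lerDl.
(* a small step from z towards the centre of the cylinder *)
pose x := z + k *: (c - z).
have Px : cylinder° x.
  have e1 : x.1 = (1 - k) * z.1 + k * (T / 2).
    by rewrite /x /=; rewrite /GRing.scale /=; ring.
  have e2 : x.2 = (1 - k) *: z.2 by rewrite /x /= sub0r scalerBl scale1r scalerN.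
  have k1' : 0 <= 1 - k by rewrite subr_ge0.
  have a1 : 0 <= (1 - k) * z.1 by exact: mulr_ge0.
  have a2 : (1 - k) * z.1 <= (1 - k) * T by exact: ler_wpM2l.
  have a3 : 0 < k * T by exact: mulr_gt0.
  apply: open_cylinder; first by rewrite e1; apply/andP; split; lra.
  rewrite e2 sqnormZ; have r20 : 0 < r ^+ 2 by rewrite exprn_gt0.
  have q0 := sqnorm_ge0 z.2; rewrite expr2.
  apply: (@le_lt_trans _ _ ((1 - k) * r ^+ 2)).
    rewrite -mulrA; apply: ler_wpM2l => //; apply: le_trans zr.
    by rewrite ler_piMl// lerBlDr lerDl ltW.
  by rewrite gtr_pMl// ltrBlDr ltrDl.
exists x; apply: hd => //; rewrite -ball_normE /= /x opprD addrA subrr add0r.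
by rewrite normrN normrZ (gtr0_norm k0).
Qed.

End cylinder.

(** * Functions whose derivatives extend to the boundary *)

Section jets_up_to_the_boundary.
Context (R : realType) (V : normedModType R) (n : nat) (e : 'I_n -> V).
Context (K : set V).

(** [F1] and [F2] are the first and second partial derivatives of [F] in the
interior of [K], extended continuously to [K]. *)
Definition jet_on (F : V -> R) (F1 : 'I_n -> V -> R)
    (F2 : 'I_n -> 'I_n -> V -> R) :=
  [/\ {within K, continuous F}, forall j, {within K, continuous (F1 j)},
      forall i j, {within K, continuous (F2 i j)},
      forall j z, K° z -> is_derive z (e j) F (F1 j z)
    & forall i j z, K° z -> is_derive z (e i) (F1 j) (F2 i j z)].

(** The filter charges the interior point [z] itself, so the limit can only be
the value. *)
Lemma derive_on_interior (F : V -> R) v z : K° z ->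
  cvg ('D_v F x @[x --> within K° (nbhs z)]) -> derive_on K F v z = 'D_v F z.
Proof.
move=> Kz; rewrite /derive_on.
have -> : within K° (nbhs z) = nbhs z.
  by apply: within_interior; exact: nbhs_interior.
set l := lim _ => cl; apply/eqP; rewrite -subr_eq0 -normr_le0.
apply/ler_addgt0Pl => eps eps0; rewrite addr0.
have /cvgrPdist_le /(_ _ eps0) h : 'D_v F x @[x --> z] --> l by exact: cl.
exact: (nbhs_singleton h).
Qed.

Lemma Ck_on_jet F : Ck_on K 2 F ->
  jet_on F (fun j => derive_on K F (e j))
    (fun i j => derive_on K (derive_on K F (e j)) (e i)).
Proof.
move=> [cF hF].
have c1 j := let: And3 _ _ h := hF (e j) in h.1.
have d2 j := let: And3 _ _ h := hF (e j) in h.2.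
split; [exact: cF|exact: c1| | |].
- by move=> i j; have [_ _] := d2 j (e i).
- move=> j z Kz; have [dF cvF _] := hF (e j).
  rewrite derive_on_interior//; last exact: cvF (interior_subset Kz).
  exact/derivableP/dF.
- move=> i j z Kz; have [dF cvF _] := d2 j (e i).
  rewrite [X in is_derive _ _ _ X]derive_on_interior//.
    exact/derivableP/dF.
  exact: cvF (interior_subset Kz).
Qed.

End jets_up_to_the_boundary.

(** * Powers of the positive part *)

Section cutoff.
Context (R : realType).

Definition pospow (k : nat) (u : R) : R := Num.max u 0 ^+ k.

Lemma pospow_continuous k : continuous (pospow k).
Proof.
move=> u; apply: (@continuous_comp _ _ _ (fun u : R => Num.max u 0) (fun x => x ^+ k)).
  by apply: continuous_max; [exact: cvg_id|exact: cvg_cst].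
exact: exprn_continuous.
Qed.

(** A form of the definition of the derivative without quotients. *)
Lemma is_derive_littleo (phi : R -> R) d :
  (forall eps, 0 < eps -> \forall h \near (0 : R),
     `|phi h - phi 0 - h * d| <= eps * `|h|) -> is_derive (0 : R) 1 phi d.
Proof.
move=> hphi.
have lim_d : (fun h : R => h^-1 *: ((phi \o shift 0) (h *: (1 : R)) - phi 0)) @ 0^' --> d.
  apply/cvgrPdist_le => eps eps0.
  rewrite near_withinE; apply: filterS (hphi _ eps0) => h hh h0.
  rewrite /= addr0 [h *: 1]mulr1 distrC.
  have -> : h^-1 *: (phi h - phi 0) - d = h^-1 * (phi h - phi 0 - h * d).
    by rewrite /GRing.scale /=; field.
  by rewrite normrM normfV ler_pdivrMl ?normr_gt0// [leRHS]mulrC.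
split; first by apply/cvg_ex; exists d.
exact: cvg_lim lim_d.
Qed.

Lemma pospow_derive k (u : R) :
  is_derive u 1 (pospow k.+2) (k.+2%:R * pospow k.+1 u).
Proof.
have [u0|u0|->] := ltgtP u 0.
- have e : \near u, cst 0 u = pospow k.+2 u.
    near=> x; rewrite /pospow max_r ?expr0n//; apply: ltW; near: x.
    exact: (cvgr_lt u (@cvg_id _ (nbhs u)) _ u0).
  apply: (near_eq_is_derive e).
  rewrite /pospow max_r ?ltW// expr0n mulr0; exact: is_derive_cst.
- have e : \near u, (id ^+ k.+2) u = pospow k.+2 u.
    near=> x; rewrite /pospow max_l; first by rewrite fctE.
    apply: ltW; near: x.
    exact: (cvgr_gt u (@cvg_id _ (nbhs u)) _ u0).
  apply: (near_eq_is_derive e).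
  rewrite /pospow max_l ?ltW//.
  apply: is_derive_eq (@is_deriveX R R id k.+2 u 1 1 (is_derive_id u (1 : R))) _.
  by rewrite [_ *: _]mulr1.
- rewrite /pospow maxxx expr0n mulr0; apply: is_derive_littleo => eps eps0.
  have m0 : 0 < Num.min 1 eps by rewrite lt_min ltr01 eps0.
  apply/nbhs_ballP; exists (Num.min 1 eps) => // h.
  rewrite -ball_normE /= sub0r normrN lt_min => /andP[h1 he].
  rewrite maxxx expr0n !subr0 mulr0 subr0 normrX.
  have hm : `|Num.max h 0| <= `|h|.
    by have [h0|h0] := leP 0 h; rewrite ?normr0.
  rewrite (@le_trans _ _ (`|h| ^+ k.+2))//.
    by rewrite ler_pXn2r// nnegrE.
  rewrite exprS mulrC ler_wpM2r// (le_trans _ (ltW he))//.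
  by rewrite exprS ler_piMr// exprn_ile1// ltW.
Unshelve. all: by end_near. Qed.

End cutoff.

(** * Extension of a function beyond the cylinder *)

Section gluing.
Context (R : realType) (V : normedModType R) (O1 O2 : set V).
Hypothesis openO2 : open O2.
Hypothesis cover : forall z, O1 z \/ O2 z.

(** A product [W * X] is regular everywhere if [W] is regular on [O1] only but
[X] vanishes on [O2].  This and the next lemma replace a definition by cases of
the extended function. *)
Lemma glue_continuous (W X : V -> R) : (forall z, O1 z -> {for z, continuous W}) ->
  continuous X -> (forall z, O2 z -> X z = 0) -> continuous (fun z => W z * X z).
Proof.
move=> cW cX X0 z; have [Oz|Oz] := cover z.
  by apply: cvgM; [exact: cW|exact: cX].
have e : \near z, cst 0 z = W z * X z.
  by apply: filterS (open_nbhs_nbhs (conj openO2 Oz)) => y Oy; rewrite X0// mulr0.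
rewrite /continuous_at X0// mulr0; apply: cvg_trans (near_eq_cvg e) _.
exact: cvg_cst.
Qed.

Lemma glue_derive (W X Wv Xv : V -> R) v :
  (forall z, O1 z -> is_derive z v W (Wv z)) ->
  (forall z, is_derive z v X (Xv z)) -> (forall z, O2 z -> X z = 0) ->
  forall z, is_derive z v (fun z => W z * X z) (W z * Xv z + Wv z * X z).
Proof.
move=> dW dX X0 z; have [Oz|Oz] := cover z.
  apply: is_derive_eq (is_deriveM (dW z Oz) (dX z)) _.
  by rewrite /GRing.scale /= [X z * _]mulrC.
have nearO2 := open_nbhs_nbhs (conj openO2 Oz).
have e : \near z, cst 0 z = W z * X z.
  by apply: filterS nearO2 => y Oy; rewrite X0// mulr0.
have e' : \near z, cst 0 z = X z.
  by apply: filterS nearO2 => y Oy; rewrite X0.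
have Xv0 : Xv z = 0.
  have [_ <-] := dX z.
  by have [_ ->] := near_eq_is_derive e' (is_derive_cst (0 : R) z v).
rewrite Xv0 X0// !mulr0 addr0.
exact: (near_eq_is_derive e (is_derive_cst (0 : R) z v)).
Qed.

Lemma vanishing_derive (X Xv : V -> R) v :
  (forall z, is_derive z v X (Xv z)) -> (forall z, O2 z -> X z = 0) ->
  forall z, O2 z -> Xv z = 0.
Proof.
move=> dX X0 z Oz.
have e' : \near z, cst 0 z = X z.
  by apply: filterS (open_nbhs_nbhs (conj openO2 Oz)) => y Oy; rewrite X0.
have [_ <-] := dX z.
by have [_ ->] := near_eq_is_derive e' (is_derive_cst (0 : R) z v).
Qed.

End gluing.

Section extension.
Context (R : realType) (n : nat) (T r : R).
Hypothesis T_gt0 : 0 < T.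
Hypothesis r_gt0 : 0 < r.
Notation Z := (R * 'cV[R]_n)%type.
Notation K := (@cylinder R n T r).
Notation e := (@ydir R n).

Lemma pospow3_C2 : Ck_along [set (1 : R)] 2 (pospow 3).
Proof.
apply/Ck_alongE; split; first exact: pospow_continuous.
move=> _ ->; exists (fun u => 3 * pospow 2 u); split; first exact: pospow_derive.
apply: Ck_alongZ; apply/Ck_alongE; split; first exact: pospow_continuous.
move=> _ ->; exists (fun u => 2 * pospow 1 u); split; first exact: pospow_derive.
exact: (Ck_alongZ (k := 0) 2 (@pospow_continuous R 1)).
Qed.

(** With [pos] the positive part, [1 - pos(1 - pos(u)^3)^3] is 0 for [u <= 0] and
1 for [u >= 1]; the cubes make it C^2 at both ends. *)
Lemma radial_cutoff r1 r2 : r1 < r2 -> exists chi : Z -> R, [/\ C2 e chi,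
  forall z, sqnorm z.2 <= r1 -> chi z = 1 &
  forall z, r2 <= sqnorm z.2 -> chi z = 0].
Proof.
move=> r12; have r21 : 0 < r2 - r1 by rewrite subr_gt0.
pose u (z : Z) := (r2 - r1)^-1 * (r2 - sqnorm z.2).
exists (fun z => 1 - pospow 3 (1 - pospow 3 (u z))); split.
- have Cu : Ck_along (range e) 2 u.
    exact: (Ck_alongZ _ (Ck_alongB (Ck_along_cst _ 2 r2) (sqnorm_smooth _ 2))).
  have C1 := Ck_along_cst (range e) 2 1.
  apply: (Ck_alongB C1).
  exact: (Ck_along_comp pospow3_C2 (Ck_alongB C1 (Ck_along_comp pospow3_C2 Cu))).
- move=> z zr; have u1 : 1 <= u z by rewrite /u mulrC ler_pdivlMr// mul1r lerD2l lerN2.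
  have p1 : 1 <= pospow 3 (u z).
    by rewrite /pospow max_l ?(le_trans ler01)// exprn_ege1.
  by rewrite [X in 1 - X]/pospow max_r ?subr_le0// expr0n subr0.
- move=> z zr; have u0 : u z <= 0 by rewrite /u mulrC ler_pdivrMr// mul0r subr_le0.
  rewrite [X in 1 - pospow _ (1 - X)]/pospow max_r// expr0n subr0.
  by rewrite /pospow max_l// expr1n subrr.
Qed.

(** Time is clamped to a smaller interval, which is continuous but not
differentiable: enough, as no time derivative is ever taken.  The state is
scaled, so that its derivatives are only multiplied by powers of [1 - k]. *)
Definition contract (k : R) (z : Z) : Z :=
  (Num.max (k * (T / 2)) (Num.min z.1 (T - k * (T / 2))), (1 - k) *: z.2).

Lemma contract_continuous k : continuous (contract k).
Proof.
have c1 : continuous (fun z : Z => Num.max (k * (T / 2)) (Num.min z.1 (T - k * (T / 2)))).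
  move=> z; apply: (@continuous_max R Z (fun=> k * (T / 2))
    (fun z : Z => Num.min z.1 (T - k * (T / 2)))); first exact: cvg_cst.
  apply: (@continuous_min R Z (fun z => z.1) (fun=> T - k * (T / 2))).
    exact: time_continuous.
  exact: cvg_cst.
have c2 : continuous (fun z : Z => (1 - k) *: z.2).
  by move=> z; apply: cvgZl_tmp; exact: cvg_snd.
by move=> z; exact: (cvg_pair (c1 z) (c2 z)).
Qed.

Lemma contract_interior k z : 0 < k < 1 -> sqnorm ((1 - k) *: z.2) < r ^+ 2 ->
  K° (contract k z).
Proof.
move=> /andP[k0 k1] zr; apply: open_cylinder => //=.
have kT : k * (T / 2) < T / 2 by rewrite gtr_pMl// divr_gt0.
have kT0 : 0 < k * (T / 2) by rewrite mulr_gt0// divr_gt0.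
rewrite lt_max kT0 /= gt_max gt_min; apply/andP; split; first lra.
by apply/orP; right; lra.
Qed.

Lemma contract_along k h j z : contract k (h *: e j + z) =
  (h * (1 - k)) *: e j + contract k z.
Proof.
rewrite /contract; congr pair => /=; first by rewrite !scaler0 !add0r.
by rewrite scalerDr scalerA mulrC.
Qed.

Lemma contract_dist k z : 0 < k < 1 -> K z ->
  `|contract k z - z| <= k * (T + `|z.2|).
Proof.
move=> /andP[k0 k1] /(cylinderE T r_gt0 z)[/andP[z0 zT] _].
have kT : k * (T / 2) < T / 2 by rewrite gtr_pMl// divr_gt0.
have kT0 : 0 < k * (T / 2) by rewrite mulr_gt0// divr_gt0.
have kz : 0 <= k * `|z.2| by rewrite mulr_ge0// ltW.
have kT1 : k * T = 2 * (k * (T / 2)) by field.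
rewrite prod_normE /= ge_max; apply/andP; split; last first.
  rewrite -[X in _ - X]scale1r -scalerBl addrAC subrr sub0r normrZ normrN gtr0_norm//.
  by rewrite mulrDr ler_wpDl// mulr_ge0// ltW.
rewrite mulrDr (@le_trans _ _ (k * T))// ?ler_wpDr//.
rewrite ler_norml; apply/andP; split.
  rewrite lerBrDr le_max; apply/orP; right; rewrite le_min; apply/andP; split; lra.
rewrite lerBlDr ge_max; apply/andP; split; first lra.
by rewrite ge_min; apply/orP; left; lra.
Qed.

(** The factor [c] stands for the powers of [1 - k] produced by the chain rule. *)
Lemma contract_close (G : Z -> R) eps : {within K, continuous G} -> 0 < eps ->
  \forall k \near (0 : R)^'+, forall c z, 1 - 2 * k <= c <= 1 -> 0 <= c -> K z ->
    `|c * G (contract k z) - G z| <= eps.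
Proof.
move=> cG eps0; have cK := @cylinder_compact R n T r r_gt0.
have eps20 : 0 < eps / 2 by rewrite divr_gt0.
have [d d0 hd] := compact_unif_continuous cK cG eps20.
have [N [_ hN]] : bounded_set (G @` K).
  by apply: compact_bounded; exact: continuous_compact.
have [N' [_ hN']] : bounded_set K by exact: compact_bounded.
pose B := `|N| + 1; pose B' := `|N'| + 1.
have B0 : 0 < B by rewrite ltr_wpDl.
have B'0 : 0 < B' by rewrite ltr_wpDl.
have GB z : K z -> `|G z| <= B.
  by move=> Kz; apply: hN; [rewrite ltr_pwDr// ler_norm|exists z].
have KB z : K z -> `|z| <= B'.
  by move=> Kz; apply: hN' => //; rewrite ltr_pwDr// ler_norm.
have dT : 0 < d / (T + B') by rewrite divr_gt0// addr_gt0.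
have eB : 0 < eps / (4 * B) by rewrite divr_gt0// mulr_gt0.
near=> k => c z /andP[ck c1] c0 Kz.
have k0 : 0 < k by near: k; exact: nbhs_right_gt.
have k1 : k < 1 by near: k; exact: nbhs_right_lt.
have kd : k < d / (T + B') by near: k; exact: nbhs_right_lt.
have ke : k < eps / (4 * B) by near: k; exact: nbhs_right_lt.
have k01 : 0 < k < 1 by rewrite k0 k1.
have Kc : K (contract k z).
  apply: interior_subset; apply: contract_interior => //; rewrite sqnormZ.
  move: Kz => /(cylinderE T r_gt0 z)[_ zr].
  apply: (@le_lt_trans _ _ ((1 - k) ^+ 2 * r ^+ 2)); first by rewrite ler_wpM2l ?sqr_ge0.
  rewrite gtr_pMl ?exprn_gt0// expr_lt1// ?subr_ge0 ?(ltW k1)//.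
  by rewrite ltrBlDr ltrDl.
have near_z : `|contract k z - z| < d.
  apply: (le_lt_trans (contract_dist k01 Kz)).
  apply: (@le_lt_trans _ _ (k * (T + B'))); last by rewrite -ltr_pdivlMr// addr_gt0.
  rewrite ler_pM2l// lerD2l (le_trans _ (KB z Kz))// prod_normE le_max lexx orbT//.
have := hd _ _ Kc Kz near_z; have := GB z Kz; move: ke; rewrite ltr_pdivlMr ?mulr_gt0//.
move: (G (contract k z)) (G z) => g' g kB gB g'g.
have -> : c * g' - g = c * (g' - g) - (1 - c) * g by ring.
rewrite (le_trans (ler_normB _ _))// !normrM (ger0_norm c0) (ger0_norm (_ : 0 <= 1 - c)) ?subr_ge0//.
have s1 : c * `|g' - g| <= eps / 2 by rewrite (le_trans _ (ltW g'g))// ler_piMl.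
have s2 : (1 - c) * `|g| <= (2 * k) * B by apply: ler_pM; rewrite ?subr_ge0//; lra.
lra.
Unshelve. all: by end_near. Qed.

Lemma contract_derive k j (G Gv : Z -> R) : 0 < k < 1 ->
  (forall z, K° z -> is_derive z (e j) G (Gv z)) ->
  forall z, sqnorm ((1 - k) *: z.2) < r ^+ 2 ->
  is_derive z (e j) (fun z => G (contract k z)) ((1 - k) * Gv (contract k z)).
Proof.
move=> k01 dG z zr; apply/is_derive_line.
have -> : (fun h : R => G (contract k (h *: e j + z))) =
    (fun h => (fun s : R => G (s *: e j + contract k z)) ((1 - k) * h)).
  by apply/funext => h; rewrite contract_along mulrC.
have daff : is_derive (0 : R) 1 (fun h : R => (1 - k) * h) (1 - k).
  apply: is_derive_eq (is_deriveZ (1 - k) (is_derive_id (0 : R) 1)) _.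
  by rewrite [_ *: _]mulr1.
have dphi : is_derive ((1 - k) * 0 : R) 1 (fun s : R => G (s *: e j + contract k z))
    (Gv (contract k z)).
  rewrite mulr0; apply: (is_derive_line G (contract k z) (e j) _).1; apply: dG.
  exact: contract_interior.
rewrite mulrC.
exact: (@is_derive_comp1 R R _ (fun h => (1 - k) * h) 0 1 _ _ dphi daff).
Qed.

(** [F := (V o contract k) * chi].  The first factor is meaningful for
[|y| < r / (1 - k)], and the cutoff is 1 in a neighbourhood of [|y| <= r] and 0
outside a smaller ball than the first one.  On the cylinder the cutoff
contributes nothing to the derivatives. *)
Lemma jet_extension (V : Z -> R) P P2 eps : jet_on e K V P P2 -> 0 < eps ->
  exists F F1 F2, [/\ C2 e F, forall j z, is_derive z (e j) F (F1 j z),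
    forall i j z, is_derive z (e i) (F1 j) (F2 i j z) &
    forall z, K z -> [/\ `|F z - V z| <= eps, forall j, `|F1 j z - P j z| <= eps
      & forall i j, `|F2 i j z - P2 i j z| <= eps]].
Proof.
move=> [cV cP cP2 dV dP] eps0.
have [k [k0 k1 close0 close1 close2]] : exists k : R, [/\ 0 < k, k < 1,
   forall c z, 1 - 2 * k <= c <= 1 -> 0 <= c -> K z ->
     `|c * V (contract k z) - V z| <= eps,
   forall j c z, 1 - 2 * k <= c <= 1 -> 0 <= c -> K z ->
     `|c * P j (contract k z) - P j z| <= eps &
   forall ij c z, 1 - 2 * k <= c <= 1 -> 0 <= c -> K z ->
     `|c * P2 ij.1 ij.2 (contract k z) - P2 ij.1 ij.2 z| <= eps].
  apply: (@filter_ex _ (0 : R)^'+); near=> k; split.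
  - by near: k; exact: nbhs_right_gt.
  - by near: k; exact: nbhs_right_lt.
  - by near: k; exact: contract_close.
  - by near: k; apply: filter_forall => j; exact: contract_close.
  - by near: k; apply: (@filter_forall _ ('I_n * 'I_n)%type) => ij; exact: contract_close.
have k01 : 0 < k < 1 by rewrite k0 k1.
have k1' : 0 < 1 - k by rewrite subr_gt0.
(* squared radii: V o contract k is differentiable below rho, and the cutoff
   decreases from 1 to 0 between r1 and r2 *)
pose rho := r ^+ 2 / (1 - k) ^+ 2.
have r20 : 0 < r ^+ 2 by rewrite exprn_gt0.
have rrho : r ^+ 2 < rho.
  rewrite /rho ltr_pdivlMr ?exprn_gt0// gtr_pMr// expr_lt1// ?(ltW k1')//.
  by rewrite ltrBlDr ltrDl.
pose r1 := r ^+ 2 + (rho - r ^+ 2) / 3; pose r2 := r ^+ 2 + 2 * (rho - r ^+ 2) / 3.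
have [rr1 r12 r2rho] : [/\ r ^+ 2 <= r1, r1 < r2 & r2 < rho].
  by rewrite /r1 /r2; split; lra.
have [chi [Cchi chi1 chi0]] := radial_cutoff r12.
pose O1 := [set z : Z | sqnorm ((1 - k) *: z.2) < r ^+ 2].
pose O2 := [set z : Z | r2 < sqnorm z.2].
have openO2 : open O2.
  apply: (@open_comp _ _ (fun z : Z => sqnorm z.2) [set x | r2 < x]).
    by move=> z _; exact: sqnorm_continuous.
  exact: open_gt.
have cover z : O1 z \/ O2 z.
  rewrite /O1 /O2 /=; have [zr|] := leP (sqnorm z.2) r2; last by right.
  left; rewrite sqnormZ mulrC -ltr_pdivlMr ?exprn_gt0//.
  exact: le_lt_trans r2rho.
have /C2P[cchi [X1 [X2 [dX dX1 cX1 cX2]]]] := Cchi.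
have chiO2 z : O2 z -> chi z = 0 by move=> /ltW; exact: chi0.
have X1O2 j : forall z, O2 z -> X1 j z = 0.
  exact (vanishing_derive openO2 (dX j) chiO2).
have X2O2 i j : forall z, O2 z -> X2 i j z = 0.
  exact (vanishing_derive openO2 (dX1 i j) (X1O2 j)).
pose W z := V (contract k z).
pose W1 j z := (1 - k) * P j (contract k z).
pose W2 i j z := (1 - k) * ((1 - k) * P2 i j (contract k z)).
have dW j z : O1 z -> is_derive z (e j) W (W1 j z).
  exact (@contract_derive k j V (P j) k01 (dV j) z).
have dW1 i j z : O1 z -> is_derive z (e i) (W1 j) (W2 i j z).
  move=> Oz; exact (is_deriveZ (1 - k) (contract_derive k01 (dP i j) Oz)).
have cG (G : Z -> R) z : {within K, continuous G} -> O1 z ->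
    {for z, continuous (fun z => G (contract k z))}.
  move=> /(subspace_continuousP K G) cG Oz.
  have Kc := contract_interior k01 Oz.
  apply: continuous_comp; first exact: contract_continuous.
  have := cG _ (interior_subset Kc).
  by rewrite (within_interior Kc).
have cW z : O1 z -> {for z, continuous W} by exact: cG.
have cW1 j z : O1 z -> {for z, continuous (W1 j)}.
  by move=> Oz; apply: cvgMl_tmp; exact: (cG _ _ (cP j) Oz).
have cW2 i j z : O1 z -> {for z, continuous (W2 i j)}.
  by move=> Oz; apply: cvgMl_tmp; apply: cvgMl_tmp; exact: (cG _ _ (cP2 i j) Oz).
pose F z := W z * chi z.
pose F1 j z := W z * X1 j z + W1 j z * chi z.
pose F2 i j z := (W z * X2 i j z + W1 i z * X1 j z)
               + (W1 j z * X1 i z + W2 i j z * chi z).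
have dF j z : is_derive z (e j) F (F1 j z).
  exact (glue_derive openO2 cover (dW j) (dX j) chiO2 z).
have dF1 i j z : is_derive z (e i) (F1 j) (F2 i j z).
  apply: is_deriveD.
    exact (glue_derive openO2 cover (dW i) (dX1 i j) (X1O2 j) z).
  exact (glue_derive openO2 cover (dW1 i j) (dX i) chiO2 z).
have gc := glue_continuous openO2 cover.
exists F, F1, F2; split; [|exact dF|exact dF1|].
  apply/C2P; split; first exact (gc _ _ cW cchi chiO2).
  exists F1, F2; split; [exact dF|exact dF1|move=> j z|move=> i j z].
    apply: cvgD; first exact (gc _ _ cW (cX1 j) (X1O2 j) z).
    exact (gc _ _ (cW1 j) cchi chiO2 z).
  apply: cvgD; apply: cvgD.
  - exact (gc _ _ cW (cX2 i j) (X2O2 i j) z).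
  - exact (gc _ _ (cW1 i) (cX1 j) (X1O2 j) z).
  - exact (gc _ _ (cW1 j) (cX1 i) (X1O2 i) z).
  - exact (gc _ _ (cW2 i j) cchi chiO2 z).
move=> z Kz.
pose O3 := [set z : Z | sqnorm z.2 < r1].
have openO3 : open O3.
  apply: (@open_comp _ _ (fun z : Z => sqnorm z.2) [set x | x < r1]).
    by move=> z' _; exact: sqnorm_continuous.
  exact: open_lt.
have O3z : O3 z.
  move: Kz => /(cylinderE T r_gt0 z)[_ zr]; rewrite /O3 /=.
  by rewrite (le_lt_trans zr)// /r1; lra.
have chiz : chi z = 1 by apply: chi1; exact: ltW.
(* the cutoff is constant near the cylinder, hence its derivatives vanish *)
have dX' j z' : is_derive z' (e j) (fun z => chi z - 1) (X1 j z').
  apply: is_derive_eq (is_deriveB (dX j z') (is_derive_cst (1 : R) z' (e j))) _.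
  by rewrite subr0.
have chi1' z' : O3 z' -> chi z' - 1 = 0 by move=> /ltW Oz'; rewrite chi1// subrr.
have X1O3 j : forall z, O3 z -> X1 j z = 0.
  exact (vanishing_derive openO3 (dX' j) chi1').
have X2z i j : X2 i j z = 0.
  exact (vanishing_derive openO3 (dX1 i j) (X1O3 j) O3z).
have X1z j : X1 j z = 0 by exact: X1O3.
have b0 : 1 - 2 * k <= (1 : R) <= 1 by rewrite lexx andbT; lra.
have b1 : 1 - 2 * k <= (1 - k : R) <= 1 by apply/andP; split; lra.
have b2 : 1 - 2 * k <= (1 - k) * (1 - k) <= 1 by apply/andP; split; nra.
split=> [|j|i j].
- by rewrite /F chiz mulr1 -[W z]mul1r; exact: close0.
- by rewrite /F1 chiz X1z mulr0 add0r mulr1; apply: close1 => //; exact: ltW.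
- rewrite /F2 chiz !X1z X2z !mulr0 !add0r mulr1 /W2 mulrA.
  by apply: (close2 (i, j)) => //; rewrite mulr_ge0// ltW.
Unshelve. all: by end_near. Qed.

End extension.

(** * Traces at the final time *)

Section boundary_values.
Context (R : realType) (n : nat) (T r : R).
Hypothesis T_gt0 : 0 < T.
Hypothesis r_gt0 : 0 < r.
Notation Z := (R * 'cV[R]_n)%type.
Notation K := (@cylinder R n T r).
Notation e := (@ydir R n).

Definition at_end (z : Z) : Z := (T, z.2).

Lemma at_end_cylinder z : K z -> K (at_end z).
Proof.
move=> /(cylinderE T r_gt0 z)[/andP[z0 zT] zr]; apply/(cylinderE T r_gt0) => /=.
by rewrite lexx ltW.
Qed.

Lemma at_end_dist x z : `|at_end x - at_end z| <= `|x - z|.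
Proof. by rewrite !prod_normE /= subrr normr0 ge_max !le_max normr_ge0 lexx orbT. Qed.

Lemma at_end_continuous (G : Z -> R) : {within K, continuous G} ->
  {within K, continuous (fun z => G (at_end z))}.
Proof.
move=> cG; apply/(subspace_continuousP K (fun z => G (at_end z))) => z Kz.
apply/cvgrPdist_le => eps eps0.
have [d d0 hd] := compact_unif_continuous (@cylinder_compact R n T r r_gt0) cG eps0.
suff : nbhs z [set x | K x -> `|G (at_end z) - G (at_end x)| <= eps] by [].
apply/nbhs_ballP; exists d => // x; rewrite -ball_normE /= => xd Kx.
apply: ltW; apply: hd; [exact: at_end_cylinder|exact: at_end_cylinder|].
exact: le_lt_trans (at_end_dist _ _) xd.
Qed.

(** At times [t < T] close to [T], the mean value inequality bounds
[F(t, y + h e_j) - F(t, y) - h Fj(T, y)] by [eps |h|], for all [h] in a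
neighbourhood of 0 that does not depend on [t]; then [t] tends to [T]. *)
Lemma at_end_derive (F Fj : Z -> R) j : {within K, continuous F} ->
  {within K, continuous Fj} -> (forall z, K° z -> is_derive z (e j) F (Fj z)) ->
  forall z, sqnorm z.2 < r ^+ 2 ->
  is_derive z (e j) (fun z => F (at_end z)) (Fj (at_end z)).
Proof.
move=> cF cFj dF z zr; apply/is_derive_line; apply: is_derive_littleo => eps eps0.
have cK := @cylinder_compact R n T r r_gt0.
have [d d0 hd] := compact_unif_continuous cK cFj eps0.
have [d1 d10 hd1] : exists2 d1, 0 < d1 &
    forall x : Z, `|z - x| < d1 -> sqnorm x.2 < r ^+ 2.
  have h : \forall x \near z, sqnorm x.2 < r ^+ 2.
    exact: (cvgr_lt (sqnorm z.2) (@sqnorm_continuous R n z) _ zr).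
  by move: h => /nbhs_normP[d1 /= d10 hd1]; exists d1.
have ne : 0 < `|e j| + 1 by rewrite ltr_wpDl.
have dm : 0 < Num.min d d1 by rewrite lt_min d0 d10.
apply/nbhs_normP; exists (Num.min d d1 / (`|e j| + 1)); first by rewrite /= divr_gt0.
move=> h /=; rewrite sub0r normrN => hh.
have step_small s : `|s| <= `|h| -> `|s *: e j| < d /\ `|s *: e j| < d1.
  move=> sh; apply/andP; rewrite -lt_min normrZ.
  apply: (@le_lt_trans _ _ (`|h| * (`|e j| + 1))); last by rewrite -ltr_pdivlMr.
  by apply: ler_pM => //; rewrite lerDl.
have in_ball s t : `|s| <= `|h| -> sqnorm (s *: e j + (t, z.2)).2 < r ^+ 2.
  move=> /step_small[_ sd1].
  have -> : (s *: e j + (t, z.2)).2 = (s *: e j + z).2 by [].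
  by apply: hd1; rewrite opprD addrCA subrr addr0 normrN.
have in_K s t : `|s| <= `|h| -> 0 <= t <= T -> K (s *: e j + (t, z.2)).
  move=> sh tT; apply/(cylinderE T r_gt0); split; last exact: ltW (in_ball s t sh).
  by rewrite /= scaler0 add0r.
have in_intK s t : `|s| <= `|h| -> 0 < t < T -> K° (s *: e j + (t, z.2)).
  move=> sh tT; apply: (open_cylinder r_gt0); last exact: in_ball.
  by rewrite /= scaler0 add0r.
have at_endE s : at_end (s *: e j + z) = s *: e j + (T, z.2).
  by rewrite /at_end; congr pair; rewrite /= scaler0 add0r.
have h0 : `|0 : R| <= `|h| by rewrite normr0.
have T01 : 0 <= T <= T by rewrite lexx ltW.
apply/ler_addgt0Pl => eps' eps'0.
have eps'20 : 0 < eps' / 2 by rewrite divr_gt0.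
have [d' d'0 hd'] := compact_unif_continuous cK cF eps'20.
(* a time strictly inside the cylinder, close enough to T *)
pose dt := Num.min (d - `|h| * `|e j|) (Num.min d' T) / 2.
have hd0 : 0 < d - `|h| * `|e j|.
  by rewrite subr_gt0 -normrZ; have [] := step_small h (lexx _).
have dt0 : 0 < dt by rewrite divr_gt0// !lt_min hd0 d'0.
have [dtd dtd' dtT] : [/\ dt < d - `|h| * `|e j|, dt < d' & dt < T].
  have : dt < Num.min (d - `|h| * `|e j|) (Num.min d' T).
    by rewrite /dt ltr_pdivrMr// ltr_pMr ?ltr1n// !lt_min hd0 d'0.
  by rewrite !lt_min => /and3P[].
pose t := T - dt.
have tT : 0 < t < T by rewrite /t subr_gt0 dtT/= gtrBl.
have tT' : 0 <= t <= T by case/andP: tT => ? ?; rewrite !ltW.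
have normT s : `|s *: e j + (T, z.2) - (s *: e j + (t, z.2))| = dt.
  rewrite opprD addrACA subrr add0r prod_normE /= subrr normr0 /t opprB addrCA subrr addr0.
  by rewrite (gtr0_norm dt0) max_l// ltW.
pose psi s := F (s *: e j + (t, z.2)) - s * Fj (T, z.2).
have dpsi (s : R) : `|s| <= `|h| ->
    is_derive s 1 psi (Fj (s *: e j + (t, z.2)) - Fj (T, z.2)).
  move=> sh; have d1' : is_derive s 1 (fun s : R => F (s *: e j + (t, z.2)))
      (Fj (s *: e j + (t, z.2))).
    apply: (is_derive_shift_line F (t, z.2) (e j) s _).1; apply: dF.
    exact: in_intK.
  have d2' : is_derive s 1 (fun s : R => s * Fj (T, z.2)) (Fj (T, z.2)).
    apply: is_derive_eq (is_deriveM (is_derive_id s (1 : R))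
      (is_derive_cst (Fj (T, z.2)) s (1 : R))) _.
    by rewrite scaler0 add0r [_ *: _]mulr1.
  exact: is_deriveB d1' d2'.
have bpsi s : `|s| <= `|h| -> `|Fj (s *: e j + (t, z.2)) - Fj (T, z.2)| <= eps.
  move=> sh; apply: ltW; apply: hd; first exact: in_K.
    by have := in_K 0 T h0 T01; rewrite scale0r add0r.
  rewrite -addrA (le_lt_trans (ler_normD _ _))//.
  have -> : `|(t, z.2) - (T, z.2)| = dt.
    by have := normT 0; rewrite !scale0r !add0r distrC.
  rewrite normrZ; move: dtd; rewrite ltrBrDl => /(le_lt_trans _); apply.
  by rewrite lerD2r ler_wpM2r.
have := increment_le dpsi bpsi (lexx `|h|).
have e1 : `|F (at_end (h *: e j + z)) - F (h *: e j + (t, z.2))| < eps' / 2.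
  rewrite at_endE; apply: hd'; [exact: in_K|exact: in_K|by rewrite normT].
have e2 : `|F (at_end (0 *: e j + z)) - F (0 *: e j + (t, z.2))| < eps' / 2.
  rewrite at_endE; apply: hd'; [exact: in_K|exact: in_K|by rewrite normT].
rewrite /psi mul0r subr0.
move: e1 e2; move: (F (h *: e j + _)) (F (0 *: e j + _)) => a0 b0.
move: (F (at_end (h *: e j + z))) (F (at_end (0 *: e j + z))) (eps * `|h|) => a1 b1 m.
rewrite -/(at_end z); move: (h * _) => q.
rewrite !ler_norml !ltr_norml.
move=> /andP[? ?] /andP[? ?] /andP[? ?]; apply/andP; split; lra.
Qed.

Lemma at_end_jet D D1 D2 : jet_on e K D D1 D2 ->
  jet_on e K (fun z => D (at_end z)) (fun j z => D1 j (at_end z))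
    (fun i j z => D2 i j (at_end z)).
Proof.
move=> [cD cD1 cD2 dD dD1]; split.
- exact: at_end_continuous.
- by move=> j; exact: at_end_continuous.
- by move=> i j; exact: at_end_continuous.
- move=> j z /(cylinder_interior T r_gt0 z)[_ zr].
  exact (at_end_derive cD (cD1 j) (dD j) zr).
- move=> i j z /(cylinder_interior T r_gt0 z)[_ zr].
  exact (at_end_derive (cD1 j) (cD2 i j) (dD1 i j) zr).
Qed.

End boundary_values.

(** * From jets back to derivatives extended by continuity *)

Section jet_algebra.
Context (R : realType) (V : normedModType R) (n : nat) (e : 'I_n -> V).
Context (K : set V).

Lemma jet_on_global F F1 F2 : C2 e F ->
  (forall j z, is_derive z (e j) F (F1 j z)) ->
  (forall i j z, is_derive z (e i) (F1 j) (F2 i j z)) -> jet_on e K F F1 F2.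
Proof.
move=> /C2P[cF [G1 [G2 [dG1 dG2 cG1 cG2]]]] dF1 dF2.
have e1 j : F1 j = G1 j.
  have [_ <-] := derive_funP (dF1 j); have [_ <-] := derive_funP (dG1 j).
  by [].
have e2 i j : F2 i j = G2 i j.
  have [_ <-] := derive_funP (dF2 i j); have [_ <-] := derive_funP (dG2 i j).
  by rewrite e1.
split; [exact: continuous_subspaceT|move=> j|move=> i j|by move=> j z _|by move=> i j z _].
- by rewrite e1; exact: continuous_subspaceT.
- by rewrite e2; exact: continuous_subspaceT.
Qed.

Lemma jet_onB F F1 F2 G G1 G2 : jet_on e K F F1 F2 -> jet_on e K G G1 G2 ->
  jet_on e K (fun z => F z - G z) (fun j z => F1 j z - G1 j z)
    (fun i j z => F2 i j z - G2 i j z).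
Proof.
have cB (f g : V -> R) : {within K, continuous f} -> {within K, continuous g} ->
    {within K, continuous (fun z => f z - g z)}.
  by move=> cf cg z; apply: cvgB; [exact: cf|exact: cg].
move=> [cF cF1 cF2 dF dF1] [cG cG1 cG2 dG dG1]; split.
- exact: cB.
- by move=> j; exact: cB.
- by move=> i j; exact: cB.
- by move=> j z Kz; exact: is_deriveB (dF j z Kz) (dG j z Kz).
- by move=> i j z Kz; exact: is_deriveB (dF1 i j z Kz) (dG1 i j z Kz).
Qed.

(** Derivatives extended by continuity see the values on [K] only.  The error of the
network value has a simple form on [K] alone, where the value at time [T] is
known. *)
Lemma jet_on_eq F G F1 F2 : (forall z, K z -> F z = G z) ->
  jet_on e K F F1 F2 -> jet_on e K G F1 F2.
Proof.
move=> FG [cF cF1 cF2 dF dF1]; split=> [|j|i j|j z Kz|i j z Kz].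
- apply: (subspace_eq_continuous _ cF) => z; rewrite inE => Kz; exact: FG.
- exact: cF1.
- exact: cF2.
- by apply: near_eq_is_derive (dF j z Kz); apply: filterS Kz => x; exact: FG.
- exact: dF1.
Qed.

Hypothesis K_dense : forall z, K z -> ProperFilter (within K° (nbhs z)).

(** The limit is unique because the interior of [K] accumulates at every point of
[K]. *)
Lemma derive_onE (F F1 : V -> R) v : {within K, continuous F1} ->
  (forall z, K° z -> is_derive z v F (F1 z)) ->
  forall z, K z -> derive_on K F v z = F1 z.
Proof.
move=> /(subspace_continuousP K F1) cF1 dF z Kz; have PF := K_dense Kz.
rewrite /derive_on; apply: cvg_lim => //.
have h : F1 x @[x --> within K° (nbhs z)] --> F1 z.
  apply: cvg_trans (cF1 z Kz); apply: cvg_app.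
  by apply: within_subset; exact: interior_subset.
apply: cvg_trans h; apply: near_eq_cvg.
rewrite near_withinE; near=> x => Kx; by have [_ ->] := dF x Kx.
Unshelve. all: by end_near. Qed.

Lemma jet_on_derive_on F F1 F2 : jet_on e K F F1 F2 -> forall z, K z ->
  (forall j, derive_on K F (e j) z = F1 j z) /\
  (forall i j, derive_on K (derive_on K F (e j)) (e i) z = F2 i j z).
Proof.
move=> [cF cF1 cF2 dF dF1] z Kz.
have e1 j x : K x -> derive_on K F (e j) x = F1 j x by exact: derive_onE.
split=> [j|i j]; first exact: e1.
apply: derive_onE => // x Kx.
apply: near_eq_is_derive (dF1 i j x Kx).
by apply: filterS Kx => y Ky; rewrite e1.
Qed.

End jet_algebra.

(** * Euclidean and operator norms *)

Section norms.
Context (R : realType).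

Lemma enorm_le_entries n (v : 'cV[R]_n) (a : R) :
  (forall i, `|v i 0| <= a) -> enorm v <= n%:R * a.
Proof.
case: n v => [|n] v hv; first by rewrite /enorm big_ord0 sqrtr0 mul0r.
have a0 : 0 <= a by exact: le_trans (hv ord0).
rewrite -(ler_pXn2r (n := 2))// ?nnegrE ?sqrtr_ge0 ?mulr_ge0//.
rewrite enorm_sqr (@le_trans _ _ (\sum_(i < n.+1) a ^+ 2))//.
  apply: ler_sum => i _; rewrite -(real_normK (num_real _)).
  by rewrite ler_pXn2r// nnegrE.
rewrite sumr_const card_ord exprMn -[leLHS]mulr_natl; apply: ler_wpM2r; first exact: sqr_ge0.
by rewrite expr2 ler_peMl// ler1n.
Qed.

Lemma opnorm_le_entries n (A : 'M[R]_n) (a : R) : 0 <= a ->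
  (forall i j, `|A i j| <= a) -> opnorm A <= n%:R * (n%:R * a).
Proof.
move=> a0 hA; apply: ge_sup.
  exists (enorm (A *m 0)), 0 => //=; rewrite /enorm.
  by under eq_bigr do rewrite mxE expr0n; rewrite sumr_const mul0rn sqrtr0.
move=> _ [x /= x1 <-]; apply: enorm_le_entries => i.
rewrite mxE (le_trans (ler_norm_sum _ _ _))//.
rewrite (@le_trans _ _ (\sum_(j < n) a))//; last first.
  by rewrite sumr_const card_ord mulr_natl.
apply: ler_sum => j _; rewrite normrM -[leRHS]mulr1 ler_pM//.
rewrite -(ler_pXn2r (n := 2))// ?nnegrE//.
rewrite (real_normK (num_real _)) (le_trans (coord_sqnorm _ _))// /sqnorm -enorm_sqr.
by rewrite ler_pXn2r ?nnegrE ?sqrtr_ge0.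
Qed.

End norms.

(** * Activation functions that are not polynomials *)

Section activation.
Context (R : realType) (sigma : R -> R).

Lemma nonpolynomial_nonzero :
  ~ (exists p : {poly R}, forall x, sigma x = p.[x]) -> exists b, sigma b != 0.
Proof.
move=> npol; apply: contrapT => h; apply: npol; exists 0 => x; rewrite horner0.
by apply/eqP; apply: contrapT => /negP sx; apply: h; exists x.
Qed.

Lemma nonpolynomial_nonaffine (s1 s2 : R -> R) :
  (forall u : R, is_derive u 1 sigma (s1 u)) ->
  (forall u : R, is_derive u 1 s1 (s2 u)) ->
  ~ (exists p : {poly R}, forall x, sigma x = p.[x]) -> exists b, s2 b != 0.
Proof.
move=> ds ds1 npol; apply: contrapT => h; apply: npol.
have s20 u : s2 u = 0.
  by apply/eqP; apply: contrapT => /negP sx; apply: h; exists u.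
have s1c u : s1 u = s1 0.
  by apply: is_derive_0_is_cst => x; rewrite -(s20 x).
have aff u : sigma u - s1 0 * u = sigma 0 - s1 0 * 0.
  apply: (@is_derive_0_is_cst _ (fun u => sigma u - s1 0 * u)) => x.
  apply: is_derive_eq (is_deriveB (ds x) (is_deriveZ (s1 0) (is_derive_id x (1 : R)))) _.
  by rewrite s1c [_ *: _]mulr1 subrr.
exists (s1 0 *: 'X + (sigma 0)%:P) => x.
by rewrite !hornerE; have := aff x; lra.
Qed.

End activation.

(** * The value function at the final time *)

Section value_at_the_end.
Context (R : realType) (n m : nat) (T : R).
Context (f : R * 'cV[R]_n -> 'cV[R]_n) (g : R * 'cV[R]_n -> 'M[R]_(n, m)).
Context (Q1 Q2 : 'M[R]_n) (beta : R) (yd : R -> 'cV[R]_n) (ydT : 'cV[R]_n).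

(** The running cost is integrated over a single point, so every admissible pair
costs the same; as the infimum of an empty set is infinite, finiteness provides
an admissible pair. *)
Lemma value_function_end y :
  value_function T f g Q1 Q2 beta yd ydT (T, y) \is a fin_num ->
  value_function T f g Q1 Q2 beta yd ydT (T, y) = (terminal_cost Q2 ydT y)%:E.
Proof.
rewrite /value_function /=; set S := (X in ereal_inf X).
have costE c : S c -> c = (terminal_cost Q2 ydT y)%:E.
  move=> [y' [u [[_ y'T _] ->]]].
  by rewrite /cost set_itv1 integral_set1 mule0 add0e y'T.
have [->|/set0P[c Sc] _] := eqVneq S set0.
  by rewrite ereal_inf0.
have -> : S = [set (terminal_cost Q2 ydT y)%:E].
  apply/seteqP; split=> x; first exact: costE.
  by move=> ->; rewrite -(costE c Sc).
exact: ereal_inf1.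
Qed.

End value_at_the_end.

(** * Approximation of the value function *)

Theorem theorem2 (R : realType) (n m : nat) (T : R)
  (f : R * 'cV[R]_n -> 'cV[R]_n) (g : R * 'cV[R]_n -> 'M[R]_(n, m))
  (Q1 Q2 : 'M[R]_n) (beta : R) (yd : R -> 'cV[R]_n) (ydT : 'cV[R]_n)
  (M : R) (sigma : R -> R)
  (T_gt0 : 0 < T)
  (f_regular : regular_coef T f) (g_regular : regular_coef T g)
  (Q1_sym : Q1^T = Q1) (Q1_psd : psd Q1)
  (Q2_sym : Q2^T = Q2) (Q2_psd : psd Q2)
  (beta_gt0 : 0 < beta) (yd_L2 : L2 0 T yd) (M_gt0 : 0 < M) :
  let ball2M := [set y : 'cV[R]_n | enorm y <= 2 * M] in
  let K := `[0, T] `*` ball2M in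
  let Vstar := value_function T f g Q1 Q2 beta yd ydT in
  let V := fun z => fine (Vstar z) in
  (forall z, K z -> Vstar z \is a fin_num) ->
  Ck_on K 2 V ->
  lipschitz_y (@enorm R n) `[0, T] ball2M (grad_y K V) ->
  lipschitz_y (@opnorm R n n) `[0, T] ball2M (hess_y K V) ->
  Ck 4 sigma ->
  ~ (exists p : {poly R}, forall x, sigma x = p.[x]) ->
  exists2 c : R, 0 < c &
    forall eps : R, 0 < eps ->
    exists (ws : seq nat) (theta_eps : net_param R (1 + n) ws),
      [/\ architecture ws,
          Ck 4 (fun p : net_param R (1 + n) ws * (R * 'cV[R]_n) =>
                  net_value T Q2 ydT sigma p.1 p.2)
        & forall z, K z ->
            let E := fun z => net_value T Q2 ydT sigma theta_eps z - V z in
            `|E z| + enorm (grad_y K E z) + opnorm (hess_y K E z)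
              <= c * eps].
Proof.
move=> ball2M K Vstar V V_fin CV _ _ Csigma npol.
have r_gt0 : 0 < 2 * M by rewrite mulr_gt0.
have Cs4 : Ck_along [set (1 : R)] 4 sigma := Ck_along_of _ Csigma.
have Cs2 : Ck_along [set (1 : R)] 2 sigma := Ck_alongW (Ck_alongW Cs4).
have [s1 [ds Cs1]] := ((Ck_alongE [set (1 : R)] 1 sigma).1 Cs2).2 1 erefl.
have [s2 [ds1 cs2]] := ((Ck_alongE [set (1 : R)] 0 s1).1 Cs1).2 1 erefl.
have [b2 s2b] := nonpolynomial_nonaffine ds ds1 npol.
have [b0 sb] := nonpolynomial_nonzero npol.
have jetV := Ck_on_jet (@ydir R n) CV.
have dense := fun z => @cylinder_interior_dense R n T (2 * M) T_gt0 r_gt0 z.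
have V_end y : enorm y <= 2 * M -> V (T, y) = terminal_cost Q2 ydT y.
  move=> yM; rewrite /V /Vstar value_function_end//.
  by apply: V_fin; split=> //=; rewrite in_itv /= lexx ltW.
exists (2 * (1 + n%:R + n%:R * n%:R)).
  by rewrite mulr_gt0// -addrA ltr_wpDr// addr_ge0// mulr_ge0.
move=> eps eps0; have eps20 : 0 < eps / 2 by rewrite divr_gt0.
have [F [F1 [F2 [CF dF dF1 FV]]]] := jet_extension T_gt0 r_gt0 jetV eps20.
have [_ appF] := @C2_approximable R n T (2 * M) sigma s1 s2 b2 (@network_space R sigma n)
  T_gt0 r_gt0 (network_space_system n Cs2)
  (fun S NS => let: And3 _ h _ := NS in h)
  (fun S j NS => let: And3 _ _ h := NS in h j) ds ds1 cs2 s2b F CF.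
have [S [NS _ [Psi SPsi Psi_F]]] := appF _ _ (network_space_input sigma n) eps20.
have CPsi : C2 (@ydir R n) Psi.
  by have [h _ _ _] := network_space_system n Cs2; exact: (h _ _ NS SPsi).
have [ws [theta [arch netE]]] := network_space_net sb NS SPsi.
exists ws, theta; split=> //; first exact: net_value_smooth.
have /C2P[_ [P1 [P2 [dP1 dP2 _ _]]]] := CPsi.
have PsiF_close : forall z, box T (2 * M) z -> [/\ `|Psi z - F z| <= eps / 2,
    forall j, `|P1 j z - F1 j z| <= eps / 2 &
    forall i j, `|P2 i j z - F2 i j z| <= eps / 2].
  apply/(c2_leP _ _ (fun j z => is_deriveB (dP1 j z) (dF j z))
    (fun i j z => is_deriveB (dP2 i j z) (dF1 i j z))).
  exact: Psi_F.
pose D z := Psi z - V z.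
pose D1 j z := P1 j z - derive_on K V (ydir R j) z.
pose D2 i j z := P2 i j z - derive_on K (derive_on K V (ydir R j)) (ydir R i) z.
have jetD : jet_on (@ydir R n) K D D1 D2.
  exact (jet_onB (jet_on_global K CPsi dP1 dP2) jetV).
have D_small z : K z -> [/\ `|D z| <= eps, forall j, `|D1 j z| <= eps
    & forall i j, `|D2 i j z| <= eps].
  move=> Kz; have [a0 a1 a2] := FV z Kz.
  have [c0 c1 c2] := PsiF_close z (cylinder_sub_box r_gt0 Kz).
  have tri (x y w : R) : `|x - y| <= eps / 2 -> `|y - w| <= eps / 2 -> `|x - w| <= eps.
    move=> h1 h2; rewrite -(subrK y x) -addrA (le_trans (ler_normD _ _))//.
    by rewrite (splitr eps) lerD.
  by split=> [|j|i j]; [exact: tri a0|exact: tri (a1 j)|exact: tri (a2 i j)].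
set E := fun z => _ - V z.
have E_D z : K z -> D z - D (at_end T z) = E z.
  move=> Kz; have [zT zM] := Kz.
  rewrite /E /net_value /D /at_end !netE /net_input V_end//=; ring.
have jetE := jet_on_eq E_D (jet_onB jetD (at_end_jet T_gt0 r_gt0 jetD)).
move=> z Kz; have Kz' := at_end_cylinder T_gt0 r_gt0 Kz.
have [b00 b01 b02] := D_small z Kz; have [b10 b11 b12] := D_small _ Kz'.
have [grE hsE] := jet_on_derive_on dense jetE Kz.
have two (x y : R) : `|x| <= eps -> `|y| <= eps -> `|x - y| <= 2 * eps.
  by move=> h1 h2; rewrite (le_trans (ler_normB _ _))// mulr_natl mulr2n lerD.
have eps2 : 0 <= 2 * eps by rewrite mulr_ge0// ltW.
have h0 : `|E z| <= 2 * eps by rewrite -E_D//; exact: two.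
have h1 : enorm (grad_y K E z) <= n%:R * (2 * eps).
  by apply: enorm_le_entries => j; rewrite mxE /partial_y grE; exact: two.
have h2 : opnorm (hess_y K E z) <= n%:R * (n%:R * (2 * eps)).
  apply: (opnorm_le_entries eps2) => i j.
  rewrite mxE (hsE i j : partial_y K (partial_y K E j) i z = _).
  exact: (two _ _ (b02 i j) (b12 i j)).
have -> : 2 * (1 + n%:R + n%:R * n%:R) * eps =
    2 * eps + n%:R * (2 * eps) + n%:R * (n%:R * (2 * eps)) by ring.
exact (lerD (lerD h0 h1) h2).
Qed.
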